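(* Let $0<\beta<1$ and $1<\alpha<2$. Let $P_{B_{\beta,\alpha}}$ and $P_{X_{\beta,\alpha}}$ be the probability measures induced on $C([0,1],\mathbb{R})$ by the generalized grey Brownian motion $B_{\beta,\alpha}=\{B_{\beta,\alpha}(t),\,t\in[0,1]\}$ and by the time-changed Brownian motion $X_{\beta,\alpha}=\{W(U_{\beta,\alpha}(t)),\,t\in[0,1]\}$, respectively. Then $P_{B_{\beta,\alpha}}$ and $P_{X_{\beta,\alpha}}$ are mutually singular.
   Context: $C([0,1],\mathbb{R})$ denotes the space of continuous functions $w:[0,1]\to\mathbb{R}$ with $w(0)=0$, equipped with the $\sigma$-algebra generated by the cylinder sets (the Borel $\sigma$-algebra of the uniform topology). Mittag-Leffler function: $E_\beta(z)=\sum_{n=0}^\infty \frac{z^n}{\Gamma(\beta n+1)}$, $z\in\mathbb{C}$. Generalized grey Brownian motion (ggBm): a continuous real-valued stochastic process $B_{\beta,\alpha}=\{B_{\beta,\alpha}(t),\,t\ge 0\}$ on a complete probability space such that $B_{\beta,\alpha}(0)=0$ almost surely and, for all $n\ge1$, $0\le t_1<\dots<t_n<\infty$ and $\theta=(\theta_1,\dots,\theta_n)\in\mathbb{R}^n$, $$\mathbb{E}\left(\exp\left(i\sum_{k=1}^n\theta_k B_{\beta,\alpha}(t_k)\right)\right)=E_\beta\left(-\tfrac12\theta^\top\Sigma_\alpha\theta\right),\qquad \Sigma_\alpha=\left(\tfrac12\left(t_k^\alpha+t_j^\alpha-|t_k-t_j|^\alpha\right)\right)_{k,j=1}^n .$$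 Time-changed Brownian motion: let $W=\{W(t),\,t\ge0\}$ be a standard Brownian motion and let $S_\beta=\{S_\beta(t),\,t\ge0\}$ be a strictly increasing $\beta$-stable subordinator independent of $W$, with $\mathbb{E}(e^{-\theta S_\beta(t)})=e^{-t\theta^\beta}$ for $\theta>0$, $t\ge 0$. Its inverse is $U_\beta(t):=\inf\{s\ge0 : S_\beta(s)>t\}$, $t\ge0$ (a process with continuous nondecreasing paths). Put $U_{\beta,\alpha}(t):=U_\beta(t^{\alpha/\beta})$ and $X_{\beta,\alpha}(t):=W(U_{\beta,\alpha}(t))$, $t\in[0,1]$. *)

(* Defs.v *)
From HB Require Import structures.
From mathcomp Require Export all_boot all_order all_algebra.
From mathcomp Require Export complex.
From mathcomp Require Export all_classical all_reals all_analysis.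
Export numFieldNormedType.Exports.

Set Implicit Arguments.
Unset Strict Implicit.
Unset Printing Implicit Defensive.

Import Order.TTheory GRing.Theory Num.Theory.

#[global] Open Scope classical_set_scope.
#[global] Open Scope complex_scope.
#[global] Open Scope ring_scope.

Definition unit_interval (R : realType) : set R := `[0, 1].
Arguments unit_interval : clear implicits.

(* Continuity is for the subspace topology on the subtype of points of [0, 1]. *)
Definition path_space (R : realType) : set (continuousType (unit_interval R) R) :=
  [set w | forall t : unit_interval R, \val t = 0 -> w t = 0].
Arguments path_space : clear implicits.

Lemma cst0_path (R : realType) :
  path_space R (mkcts (fun x => @cst_continuous (unit_interval R) R 0 x)).
Proof. by move=> t _. Qed.

HB.instance Definition _ (R : realType) :=
  isPointed.Build (path_space R) (SigSub (mem_set (@cst0_path R))).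

Definition cylinders (R : realType) : set (set (path_space R)) :=
  [set C | exists n (t : 'I_n -> unit_interval R) (A : 'I_n -> set R),
    (forall i, measurable (A i)) /\
    C = [set w : path_space R | forall i, A i (\val w (t i))]].
Arguments cylinders : clear implicits.

Notation C01 R := (g_sigma_algebraType (cylinders R)).

Definition mutually_singular d (T : measurableType d) (R : realType)
    (mu nu : set T -> \bar R) :=
  exists A : set T, [/\ measurable A, mu A = 0%E & nu (~` A) = 0%E].

(* The law of a process Y with almost surely continuous paths starting at 0 is
   the distribution of any path-valued random variable Z whose path is, almost
   surely, that of Y on [0, 1]; it does not depend on the choice of Z. *)
Definition is_path_of d (T : measurableType d) (R : realType)
    (P : probability T R) (Y : R -> T -> R) (Z : T -> C01 R) :=
  {ae P, forall w, forall t : unit_interval R,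
    \val (Z w) t = Y (\val t) w}.

(* On a complete probability space every process with almost surely continuous
   paths starting at 0 has such a Z. *)
Lemma is_path_of_exists d (T : measurableType d) (R : realType)
    (P : probability T R) (Y : R -> T -> R) :
  measure_is_complete P ->
  (forall t, 0 <= t -> measurable_fun setT (Y t)) ->
  {ae P, forall w, {within unit_interval R, continuous (fun t => Y t w)} /\ Y 0 w = 0} ->
  exists Z : {mfun T >-> C01 R}, is_path_of P Y Z.
Proof.
move=> cP mY good.
pose G := [set w | exists p : path_space R, forall t, \val p t = Y (\val t) w].
have aeG : {ae P, forall w, G w}.
  apply: filterS good => w [cw w0].
  have cw' : continuous (sigL (unit_interval R) (fun t => Y t w)).
    exact/subspace_sigL_continuousP.
  have h : path_space R (mkcts cw').
    move=> t t0; change (Y (\val t) w = 0); by rewrite t0.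
  by exists (SigSub (mem_set h)).
have mG : measurable G by rewrite -(setCK G); apply: measurableC; exact: cP.
pose Z w : C01 R := match pselect (G w) with
  | left g => sval (cid g) | right _ => point end.
have ZG w : G w -> forall t, \val (Z w) t = Y (\val t) w.
  by rewrite /Z => Gw; case: pselect => // g; case: cid.
have ZN w : ~ G w -> Z w = point by rewrite /Z; case: pselect.
have mZ : measurable_fun setT Z.
  apply: (@measurability _ _ _ (C01 R) setT Z (cylinders R)) => //.
  move=> _ [_ [n [t [A [mA ->]]]] <-]; rewrite setTI.
  set C := [set w : path_space R | _].
  have -> : Z @^-1` C =
     (G `&` \bigcap_i (Y (\val (t i)) @^-1` A i)) `|` (~` G `&` [set w | C point]).
    apply/seteqP; split => w /=.
      have [Gw Cw|nG] := pselect (G w).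
        by left; split=> // i _ /=; rewrite -ZG//; exact: Cw.
      by rewrite ZN// => ?; right.
    case => [[Gw Aw] i|[nG]]; last by rewrite ZN.
    by rewrite ZG//; exact: Aw.
  apply: measurableU; apply: measurableI => //.
  - apply: fin_bigcap_measurable; first exact: finite_finset.
    move=> i _; rewrite -[X in measurable X]setTI; apply: mY => //.
    by case: (t i) => x /= /set_mem; rewrite /unit_interval /= in_itv/= => /andP[].
  - exact: measurableC.
  - case: (pselect (C point)) => h.
      by rewrite (_ : [set _ | _] = setT) //; apply/seteqP; split.
    by rewrite (_ : [set _ | _] = set0) //; apply/seteqP; split.
pose mf := isMeasurableFun.Build _ _ _ (C01 R) Z mZ.
pose Zm : {mfun T >-> C01 R} := HB.pack Z mf.
exists Zm; apply: filterS aeG => w Gw t; exact: ZG.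
Qed.

Definition gamma (R : realType) (x : R) : R :=
  Rintegral lebesgue_measure `]0, +oo[ (fun t => t `^ (x - 1) * expR (- t)).

(* R[i]^o is R[i] with the topology of its norm. *)
Definition mittag_leffler (R : realType) (beta : R) (z : R[i]) : R[i] :=
  limn (series (fun k => z ^+ k / (gamma (beta * k%:R + 1))%:C) :
          nat -> R[i]^o).

(* E[exp(i X)], with real and imaginary parts integrated separately. *)
Definition expectation_expi d (T : measurableType d) (R : realType)
    (P : probability T R) (X : T -> R) : R[i] :=
  fine 'E_P[cos \o X]%E +i* fine 'E_P[sin \o X]%E.

Section processes.
Context d (T : measurableType d) (R : realType) (P : probability T R).

(* A process is indexed by the whole of R for convenience; only its values at
   nonnegative times are ever constrained or used. *)
Implicit Types Y W S : R -> {RV P >-> R}.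

Definition continuous_process Y :=
  {ae P, forall w, {within `[0, +oo[, continuous (fun t => Y t w)}}.

Definition starts_at_0 Y := {ae P, forall w, Y 0 w = 0}.

Definition mutually_independent n (X : 'I_n -> T -> R) :=
  forall A : 'I_n -> set R, (forall i, measurable (A i)) ->
    P (\bigcap_i (X i @^-1` A i)) = (\prod_(i < n) P (X i @^-1` A i))%E.

Definition independent_increments Y :=
  forall (n : nat) (t : nat -> R), 0 <= t 0 -> nondecreasing_seq t ->
    mutually_independent (fun i : 'I_n => Y (t i.+1) \- Y (t i)).

Definition stationary_increments Y :=
  forall s t, 0 <= s -> s <= t -> forall A : set R, measurable A ->
    P ((Y t \- Y s) @^-1` A) = P (Y (t - s) @^-1` A).

Definition process_sigma_algebra Y : set (set T) :=
  <<s [set E | exists t (A : set R),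
         [/\ 0 <= t, measurable A & E = Y t @^-1` A]] >>.

Definition independent_processes Y1 Y2 :=
  forall E F, process_sigma_algebra Y1 E -> process_sigma_algebra Y2 F ->
    P (E `&` F) = (P E * P F)%E.

Record is_brownian_motion W : Prop := {
  bm_starts_at_0 : starts_at_0 W;
  bm_independent_increments : independent_increments W;
  (* the second parameter of normal_prob is the standard deviation *)
  bm_gaussian_increments : forall s t, 0 <= s -> s < t ->
    forall A : set R, measurable A ->
    P ((W t \- W s) @^-1` A) = normal_prob 0 (Num.sqrt (t - s)) A;
  bm_continuous : continuous_process W }.

Definition cadlag_process Y :=
  {ae P, forall w, forall t, 0 <= t ->
    Y s w @[s --> t^'+] --> Y t w /\
    (0 < t -> cvg (Y s w @[s --> t^'-]))}.

Definition strictly_increasing_process Y :=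
  {ae P, forall w, forall s t, 0 <= s -> s < t -> Y s w < Y t w}.

Record is_stable_subordinator (beta : R) S : Prop := {
  sub_starts_at_0 : starts_at_0 S;
  sub_independent_increments : independent_increments S;
  sub_stationary_increments : stationary_increments S;
  sub_cadlag : cadlag_process S;
  sub_strictly_increasing : strictly_increasing_process S;
  sub_laplace : forall theta t, 0 < theta -> 0 <= t ->
    'E_P[fun w => expR (- theta * S t w)]%E =
    (expR (- t * theta `^ beta))%:E }.

Definition ggBm_cov (alpha : R) n (t : 'I_n -> R) : 'M[R]_n :=
  \matrix_(k, j)
    (2^-1 * (t k `^ alpha + t j `^ alpha - `|t k - t j| `^ alpha)).

Record is_ggBm (beta alpha : R) (B : R -> {RV P >-> R}) : Prop := {
  ggBm_complete : measure_is_complete P;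
  ggBm_continuous : continuous_process B;
  ggBm_starts_at_0 : starts_at_0 B;
  ggBm_charfun : forall (n : nat) (t : 'I_n -> R) (theta : 'cV[R]_n),
    (0 < n)%N -> (forall k, 0 <= t k) ->
    (forall k j : 'I_n, (k < j)%N -> t k < t j) ->
    expectation_expi P (fun w => \sum_(k < n) theta k 0 * B (t k) w) =
    mittag_leffler beta
      (- 2^-1 * (theta^T *m ggBm_cov alpha t *m theta) 0 0)%:C }.

Definition inverse_process S (t : R) (w : T) : R :=
  inf [set s | 0 <= s /\ t < S s w].

Definition time_changed_BM (beta alpha : R) W S (t : R) (w : T) : R :=
  W (inverse_process S (t `^ (alpha / beta)) w) w.

End processes.

(* Main.v *)
(** Both laws are separated by the event that the quadratic variations [V_n] along
    the dyadic partitions of [0, 1] are summable.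

    For the generalized grey Brownian motion, an increment over a step [h] has
    characteristic function [E_beta (- th^2 h^alpha / 2)], and
    [E (2 - 2 cos (th X)) / th^2] tends to [E X^2] as [th] tends to [0]; since
    [1 - E_beta (- q) = O(q)], the second moment of the increment is [O(h^alpha)].
    Hence [E V_n = O(2^(n (1 - alpha)))] is summable.

    For the time-changed Brownian motion [W (U t)] it suffices that almost surely [V_n] does not
    tend to [0].  Given the subordinator, [V_n] is a sum of squares of independent
    centered Gaussians of variances [dU_k], so that
    [E exp (- l V_n) <= E prod_k (1 + 2 l dU_k)^(-1/2) <= E (1 + 2 l U 1)^(-1/2)],
    uniformly in [n], and the right-hand side tends to [0] as [l] grows because
    [U 1 > 0].  To avoid conditioning, [U] is first replaced by a finite-valued
    approximation that counts the grid times at which [S] is below a given level. *)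

Require Import Defs.
From mathcomp Require Import measurable_realfun ring lra.

Set Implicit Arguments.
Unset Strict Implicit.
Unset Printing Implicit Defensive.

Import Order.TTheory GRing.Theory Num.Theory.

(** * Densities and independence *)

Section density.
Local Open Scope ereal_scope.
Import HBNNSimple.
Context d' (U : measurableType d') (R : realType).

(** Approximation of [f] from below by simple functions. On the right-hand side [mu], [X] and [G]
    enter only through the integrals of [G] over preimages under [X], which allows two such triples
    to be compared. *)
Let ge0_integral_density_lim d (T : measurableType d)
    (mu : {measure set T -> \bar R}) (X : T -> U) (G : T -> R) (f : U -> \bar R)
    (mf : measurable_fun setT f) :
  measurable_fun setT X -> measurable_fun setT G ->
  (forall x, (0 <= G x)%R) -> (forall y, 0 <= f y) ->
  \int[mu]_x (f (X x) * (G x)%:E) =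
  limn (fun n => \sum_(r \in range (nnsfun_approx measurableT mf n))
    r%:E * \int[mu]_(x in X @^-1` (nnsfun_approx measurableT mf n @^-1` [set r]))
      (G x)%:E).
Proof.
move=> mX mG G0 f0.
have mGE : measurable_fun setT (EFin \o G) by exact/measurable_EFinP.
pose f_ := nnsfun_approx measurableT mf.
have mfX n : measurable_fun setT (fun x => (f_ n (X x))%:E * (G x)%:E).
  apply: emeasurable_funM => //; apply/measurable_EFinP.
  exact: measurableT_comp.
rewrite -/f_; under [in RHS]eq_fun => n.
  rewrite (_ : \sum_(r \in _) _ = \int[mu]_x ((f_ n (X x))%:E * (G x)%:E)).
    over.
  under [RHS]eq_integral.
    move=> x _; rewrite fimfunE -fsumEFin// ge0_mule_fsuml; last first.
      by move=> *; rewrite EFinM nnfun_muleindic_ge0.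
    over.
  rewrite ge0_integral_fsum//; last 2 first.
  - move=> r; apply: emeasurable_funM => //; apply/measurable_EFinP => //=.
    by apply: measurable_funM => //; apply: measurableT_comp.
  - by move=> r x _; rewrite mule_ge0// ?lee_fin//; exact: nnfun_muleindic_ge0.
  apply: eq_fsbigr => r /set_mem [y _ fy].
  have r0 : (0 <= r)%R by rewrite -fy.
  under [RHS]eq_integral do rewrite EFinM -muleA.
  rewrite ge0_integralZl//; last first.
  - by move=> x _; rewrite mule_ge0// lee_fin.
  - apply: emeasurable_funM => //; apply/measurable_EFinP => //=.
    exact: measurableT_comp.
  rewrite integral_mkcond; congr (_ * _); apply: eq_integral => x _.
  rewrite /patch indicE.
  have -> : (X x \in f_ n @^-1` [set r]) = (x \in X @^-1` (f_ n @^-1` [set r])).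
    by apply/idP/idP; rewrite !inE.
  by case: ifP => _; rewrite ?mul1e ?mul0e.
rewrite -monotone_convergence//.
- apply: eq_integral => x _; apply/esym/cvg_lim => //.
  by apply: cvgeZr => //; exact: cvg_nnsfun_approx.
- by move=> n x _; rewrite mule_ge0// lee_fin.
- move=> x _ a b ab; apply: lee_wpmul2r; first by rewrite lee_fin.
  by rewrite lee_fin; exact/lefP/nd_nnsfun_approx.
Qed.

(** This acts as a change of variables stated directly on integrals. It is used with a constant
    weight to exploit independence, and with the normal density over Lebesgue measure to integrate
    Gaussian variables. *)
Lemma eq_ge0_integral_density d1 (T1 : measurableType d1)
    (mu1 : {measure set T1 -> \bar R}) (X1 : T1 -> U) (G1 : T1 -> R)
    d2 (T2 : measurableType d2)
    (mu2 : {measure set T2 -> \bar R}) (X2 : T2 -> U) (G2 : T2 -> R) :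
  measurable_fun setT X1 -> measurable_fun setT G1 -> (forall x, (0 <= G1 x)%R) ->
  measurable_fun setT X2 -> measurable_fun setT G2 -> (forall x, (0 <= G2 x)%R) ->
  (forall A, measurable A -> \int[mu1]_(x in X1 @^-1` A) (G1 x)%:E =
                             \int[mu2]_(x in X2 @^-1` A) (G2 x)%:E) ->
  forall f : U -> \bar R, measurable_fun setT f -> (forall y, 0 <= f y) ->
  \int[mu1]_x (f (X1 x) * (G1 x)%:E) = \int[mu2]_x (f (X2 x) * (G2 x)%:E).
Proof.
move=> mX1 mG1 G10 mX2 mG2 G20 GG f mf f0.
rewrite !(ge0_integral_density_lim _ mf)//; congr (limn _); apply/funext => n.
by apply: eq_fsbigr => r _; rewrite GG.
Qed.

End density.

Section independence.
Context d (T : measurableType d) (R : realType) (P : probability T R).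

Lemma indep_integral_prod n (X : 'I_n -> T -> R) :
  (forall i, measurable_fun setT (X i)) -> mutually_independent P X ->
  forall (g : 'I_n -> R -> R) (e : 'I_n -> R),
  (forall i, measurable_fun setT (g i)) -> (forall i x, 0 <= g i x) ->
  (forall i, \int[P]_x (g i (X i x))%:E = (e i)%:E)%E ->
  (\int[P]_x (\prod_i g i (X i x))%:E = (\prod_i e i)%:E)%E.
Proof.
move=> mX indX.
have mXA i A : measurable A -> measurable (X i @^-1` A).
  by move=> mA; rewrite -[X in measurable X]setTI; exact: mX.
(* Indicators are replaced by general functions one index at a time. *)
suff H j : (j <= n)%N -> forall (g : 'I_n -> R -> R) (e : 'I_n -> R),
    (forall i : 'I_n, (j <= i)%N -> exists2 A, measurable A & g i = \1_A) ->
    (forall i, measurable_fun setT (g i)) -> (forall i x, 0 <= g i x) ->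
    (forall i, \int[P]_x (g i (X i x))%:E = (e i)%:E)%E ->
    (\int[P]_x (\prod_i g i (X i x))%:E = (\prod_i e i)%:E)%E.
  move=> g e; apply: (H n) => // i; by rewrite leqNgt ltn_ord.
elim: j => [_|j IH jn] g e gA mg g0 ge.
  have /choice[A AP] : forall i, exists A, measurable A /\ g i = \1_A.
    by move=> i; have [A mA gi] := gA i isT; exists A.
  have -> : (fun x => (\prod_i g i (X i x))%:E) =
            (fun x => (\1_(\bigcap_i (X i @^-1` A i)) x)%:E).
    apply/funext => x; congr EFin; rewrite indicE.
    have [/set_mem xA|/negP xA] := boolP (x \in _).
      by rewrite big1// => i _; rewrite (AP i).2 indicE mem_set//; exact: xA.
    have [i nA] : exists i, ~ A i (X i x).
      apply: contra_notP xA => nA; rewrite inE => i _.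
      by apply: contra_notP nA => ?; exists i.
    by rewrite (bigD1 i)//= (AP i).2 indicE memNset// mul0r.
  rewrite integral_indic//; last first.
    apply: fin_bigcap_measurable => // i _.
    exact: mXA (AP i).1.
  rewrite setIT; transitivity (\prod_(i < n) P (X i @^-1` A i))%E.
    by apply: (indX A) => i; exact: (AP i).1.
  rewrite -prodEFin; apply: eq_bigr => i _; rewrite -ge (AP i).2.
  have -> : (fun x => (\1_(A i) (X i x))%:E) =
            (fun x => (\1_(X i @^-1` A i) x)%:E) :> (T -> \bar R) by [].
  rewrite integral_indic ?setIT//.
  exact: mXA (AP i).1.
pose k := Ordinal jn.
have mgX i : measurable_fun setT (fun x => g i (X i x)).
  exact: measurableT_comp.
pose G x := \prod_(i | i != k) g i (X i x).
pose c := \prod_(i | i != k) e i.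
have mG : measurable_fun setT G.
  by rewrite /G; under eq_fun do rewrite -big_filter; exact: measurable_prod.
have G0 x : 0 <= G x by exact: prodr_ge0.
have e0 i : 0 <= e i.
  by rewrite -lee_fin -ge; apply: integral_ge0 => x _; rewrite lee_fin.
have c0 : 0 <= c by exact: prodr_ge0.
have -> : (\int[P]_x (\prod_i g i (X i x))%:E =
  \int[P]_x ((g k (X k x))%:E * (G x)%:E))%E.
  by apply: eq_integral => x _; rewrite (bigD1 k)//= EFinM.
(* The remaining factors [G] are replaced by the product [c] of their means. Both have the same
   integral over any event on [X k], by the induction hypothesis with the indicator of [A] in place
   of [g k]. *)
rewrite (@eq_ge0_integral_density _ _ _ _ _ P (X k) G _ _ P (X k) (cst c)
  _ _ _ _ _ _ _ (EFin \o g k))//.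
- rewrite /= ge0_integralZr//; last 2 first.
  + exact/measurable_EFinP.
  + by move=> x _; rewrite lee_fin.
  by rewrite /= ge (bigD1 k).
- move=> A mA.
  have mXkA := mXA k _ mA.
  pose g' i := if i == k then \1_A else g i.
  pose e' i := if i == k then fine (P (X k @^-1` A)) else e i.
  have := IH (ltnW jn) g' e' _ _ _ _.
  rewrite (bigD1 k)//= {2}/e' eqxx (eq_bigr e); last first.
    by move=> i /negbTE ik; rewrite /e' ik.
  rewrite -/c => IH'.
  rewrite integral_cst// -[X in (c%:E * X)%E]fineK ?fin_num_measure// -EFinM mulrC -IH'.
  + rewrite [LHS]integral_mkcond; apply: eq_integral => x _.
    rewrite (bigD1 k)//= /g' eqxx (eq_bigr (fun i => g i (X i x))); last first.
      by move=> i /negbTE ik; rewrite ik.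
    rewrite /patch indicE -/(G x).
    have -> : (X k x \in A) = (x \in X k @^-1` A) by apply/idP/idP; rewrite !inE.
    by case: ifP => _; rewrite ?mul1r ?mul0r.
  + move=> i ji; rewrite /g'; case: eqP => [_|/eqP ik]; first by exists A.
    apply: gA; rewrite ltn_neqAle ji andbT; apply: contra ik => /eqP jk.
    exact/eqP/val_inj.
  + by move=> i; rewrite /g'; case: ifP => _ //.
  + by move=> i x; rewrite /g'; case: ifP => _ //.
  + move=> i; rewrite /g' /e'; case: eqP => [->|_] //.
    rewrite fineK ?fin_num_measure//.
    have -> : (fun x => (\1_A (X k x))%:E) =
              (fun x => (\1_(X k @^-1` A) x)%:E) :> (T -> \bar R) by [].
    by rewrite integral_indic ?setIT.
- exact/measurable_EFinP.
- by move=> y; rewrite lee_fin.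
Qed.

(** The density lemma with weights [\1_F] and the constant [fine (P F)]. Later [F] is an event of
    the subordinator and [Y] a functional of the Brownian motion. *)
Lemma indep_integral_indic (F : set T) (Y : T -> R) (f : R -> R) :
  measurable F -> measurable_fun setT Y -> measurable_fun setT f ->
  (forall x, 0 <= f x) ->
  (forall A, measurable A -> P (F `&` Y @^-1` A) = (P F * P (Y @^-1` A))%E) ->
  (\int[P]_(x in F) (f (Y x))%:E = P F * \int[P]_x (f (Y x))%:E)%E.
Proof.
move=> mF mY mf f0 FY.
have mYA A : measurable A -> measurable (Y @^-1` A).
  by move=> mA; rewrite -[X in measurable X]setTI; exact: mY.
have -> : (\int[P]_(x in F) (f (Y x))%:E = \int[P]_x ((f (Y x))%:E * (\1_F x)%:E))%E.
  rewrite integral_mkcond; apply: eq_integral => x _; rewrite /patch indicE.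
  by case: ifP => _; rewrite ?mule1 ?mule0.
rewrite (@eq_ge0_integral_density _ _ _ _ _ P Y \1_F _ _ P Y (cst (fine (P F)))
  _ _ _ _ _ _ _ (EFin \o f))//.
- rewrite /= ge0_integralZr//; last 3 first.
  + by apply/measurable_EFinP; exact: measurableT_comp.
  + by move=> x _; rewrite lee_fin.
  + by rewrite lee_fin fine_ge0.
  by rewrite /= fineK ?fin_num_measure// muleC.
- by move=> x /=; rewrite fine_ge0.
- move=> A mA; rewrite integral_indic//; last exact: mYA.
  rewrite (integral_cst P (mYA _ mA) (fine (P F))%:E) fineK ?fin_num_measure//.
  exact: FY.
- exact/measurable_EFinP.
Qed.

End independence.

(** * Squares of Brownian increments *)

Section brownian.
Context d (T : measurableType d) (R : realType) (P : probability T R).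

Let sqrtrM_scale (s c p : R) : 0 < c ->
  Num.sqrt ((s * c) ^+ 2 * p *+ 2) = c * Num.sqrt (s ^+ 2 * p *+ 2).
Proof.
move=> c0.
have -> : (s * c) ^+ 2 * p *+ 2 = c ^+ 2 * (s ^+ 2 * p *+ 2) by ring.
by rewrite sqrtrM ?sqr_ge0// sqrtr_sqr gtr0_norm.
Qed.

(* Completing the square; [p] stands for [pi]. *)
Let normal_scaling (s l x p : R) : 0 < s -> 0 <= l ->
  let c := (Num.sqrt (1 + 2 * l * s ^+ 2))^-1 in
  expR (- l * x ^+ 2) *
    ((Num.sqrt (s ^+ 2 * p *+ 2))^-1 * expR (- x ^+ 2 / (s ^+ 2 *+ 2))) =
  c * ((Num.sqrt ((s * c) ^+ 2 * p *+ 2))^-1 *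
    expR (- x ^+ 2 / ((s * c) ^+ 2 *+ 2))).
Proof.
move=> s0 l0 c.
have d0 : 0 < 1 + 2 * l * s ^+ 2 by have := mulr_ge0 l0 (sqr_ge0 s); lra.
have c0 : 0 < c by rewrite invr_gt0 sqrtr_gt0.
have c2 : c ^+ 2 = (1 + 2 * l * s ^+ 2)^-1 by rewrite exprVn sqr_sqrtr// ltW.
clearbody c; rewrite (sqrtrM_scale _ _ c0).
move: (Num.sqrt _) => q; rewrite invfM !mulrA (mulfV (lt0r_neq0 c0)) mul1r.
rewrite mulrAC -expRD mulrC; congr (_ * expR _).
rewrite exprMn c2; field.
by rewrite !gt_eqF.
Qed.

(** Multiplying the centered normal density of deviation [s] by [expR (- l * x ^+ 2)] gives [c]
    times the centered normal density of deviation [s * c], which integrates to 1. *)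
Lemma integral_expR_sqr_normal (Z : T -> R) (s l : R) :
  measurable_fun setT Z -> 0 < s -> 0 <= l ->
  (forall A, measurable A -> P (Z @^-1` A) = normal_prob 0 s A) ->
  (\int[P]_x (expR (- l * Z x ^+ 2))%:E =
   ((Num.sqrt (1 + 2 * l * s ^+ 2))^-1)%:E)%E.
Proof.
move=> mZ s0 l0 ZA.
set c := (Num.sqrt _)^-1.
have d0 : 0 < 1 + 2 * l * s ^+ 2 by have := mulr_ge0 l0 (sqr_ge0 s); lra.
have c0 : 0 < c by rewrite invr_gt0 sqrtr_gt0.
have sc0 : 0 < s * c by exact: mulr_gt0.
have mexp : measurable_fun setT (fun z : R => expR (- l * z ^+ 2)).
  by apply: measurableT_comp => //; apply: measurable_funM => //; exact: measurable_funX.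
transitivity (\int[P]_x
    ((EFin \o (fun z => expR (- l * z ^+ 2))) (Z x) * (cst 1 x)%:E))%E.
  by apply: eq_integral => x _; rewrite /= mule1.
rewrite (@eq_ge0_integral_density _ _ _ _ _ P Z (cst 1) _ _ lebesgue_measure
  (@idfun R) (normal_pdf 0 s))//=.
- transitivity (\int[lebesgue_measure]_x (c%:E * (normal_pdf 0 (s * c) x)%:E))%E.
    apply: eq_integral => x _; rewrite -!EFinM; congr EFin.
    rewrite (normal_pdfE _ (lt0r_neq0 s0)) (normal_pdfE _ (lt0r_neq0 sc0)).
    rewrite /normal_peak /normal_fun !subr0.
    exact: normal_scaling.
  rewrite ge0_integralZl//.
  + by rewrite integral_normal_pdf mule1.
  + by apply/measurable_EFinP; exact: measurable_normal_pdf.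
  + by move=> x _; rewrite lee_fin normal_pdf_ge0.
  + by rewrite lee_fin ltW.
- exact: measurable_id.
- exact: measurable_normal_pdf.
- by move=> x; exact: normal_pdf_ge0.
- move=> A mA; rewrite integral_cst ?mul1e//.
    exact: ZA.
  by rewrite -[X in measurable X]setTI; exact: mZ.
- exact/measurable_EFinP.
Qed.

Variables (W : R -> {RV P >-> R}) (hW : is_brownian_motion W).

(** Independence turns the integral into a product of factors [(1 + a_i)^(-1/2)] with
    [a_i = 2 l (q (i+1) - q i) >= 0]. The product of the [1 + a_i] is at least [1] plus the sum of
    the [a_i], and this sum telescopes, so the bound sees only the endpoints. *)
Lemma integral_expR_quadratic_variation (l : R) (n : nat) (q : nat -> R) :
  0 <= l -> 0 <= q 0 -> nondecreasing_seq q ->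
  (\int[P]_x (expR (- l * \sum_(i < n) (W (q i.+1) x - W (q i) x) ^+ 2))%:E <=
   ((Num.sqrt (1 + 2 * l * (q n - q 0%N)))^-1)%:E)%E.
Proof.
move=> l0 q0 ndq.
have dq i : 0 <= q i.+1 - q i by rewrite subr_ge0; exact: ndq.
pose e (i : 'I_n) := (Num.sqrt (1 + 2 * l * (q i.+1 - q i)))^-1.
have mD i : measurable_fun setT (W (q i.+1) \- W (q i)) by exact: measurable_funB.
have mexp : measurable_fun setT (fun z : R => expR (- l * z ^+ 2)).
  by apply: measurableT_comp => //; apply: measurable_funM => //; exact: measurable_funX.
have He (i : 'I_n) :
    (\int[P]_x (expR (- l * (W (q i.+1) \- W (q i)) x ^+ 2))%:E = (e i)%:E)%E.
  (* A step of length zero is treated apart, since the Gaussian law of the increments is given for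
     [s < t]. *)
  have := dq i; rewrite le0r => /predU1P[eqi|lti].
    have qi : q i.+1 = q i by apply/eqP; rewrite -subr_eq0 eqi.
    rewrite /e eqi mulr0 addr0 sqrtr1 invr1 -[RHS](@probability_setT _ _ _ P).
    rewrite -[RHS]mul1e -integral_cst//; apply: eq_integral => x _.
    by rewrite /= qi subrr expr0n mulr0 expR0.
  rewrite (@integral_expR_sqr_normal _ (Num.sqrt (q i.+1 - q i)))//.
  - by rewrite sqr_sqrtr.
  - by rewrite sqrtr_gt0.
  - move=> A mA; apply: bm_gaussian_increments => //.
      by rewrite (le_trans q0)//; exact: ndq.
    by rewrite -subr_gt0.
have := @indep_integral_prod _ _ _ P n _ (fun i => mD i)
  (bm_independent_increments hW q0 ndq)
  (fun _ z => expR (- l * z ^+ 2)) e (fun=> mexp) (fun _ _ => expR_ge0 _) He.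
under eq_integral do rewrite -expR_sum -mulr_sumr.
move=> ->; rewrite lee_fin.
suff : (Num.sqrt (1 + 2 * l * (q n - q 0%N))) <= \prod_(i < n) (e i)^-1.
  have sqrt_gt0 : 0 < Num.sqrt (1 + 2 * l * (q n - q 0%N)).
    rewrite sqrtr_gt0; have : 0 <= q n - q 0%N by rewrite subr_ge0; exact: ndq.
    by move=> /(mulr_ge0 l0); lra.
  have prod_gt0 : 0 < \prod_(i < n) e i.
    apply: prodr_gt0 => i _; rewrite invr_gt0 sqrtr_gt0.
    by have := mulr_ge0 l0 (dq i); lra.
  move=> h; rewrite -[leLHS]invrK lef_pV2 ?posrE ?invr_gt0//.
  by rewrite -prodfV.
under eq_bigr do rewrite invrK.
have S k : \prod_(i < k) Num.sqrt (1 + 2 * l * (q i.+1 - q i)) =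
           Num.sqrt (\prod_(i < k) (1 + 2 * l * (q i.+1 - q i))).
  elim: k => [|k IH]; first by rewrite !big_ord0 sqrtr1.
  rewrite !big_ord_recr/= IH sqrtrM// prodr_ge0// => i _.
  by have := mulr_ge0 l0 (dq i); lra.
rewrite S ler_sqrt; last by rewrite prodr_ge0// => i _; have := mulr_ge0 l0 (dq i); lra.
elim: n {e He} => [|k IH]; first by rewrite big_ord0 subrr mulr0 addr0.
rewrite big_ord_recr/=.
apply: le_trans (ler_wpM2r _ IH); last by have := mulr_ge0 l0 (dq k); lra.
have h1 := mulr_ge0 l0 (dq k).
have h2 : 0 <= l * (q k - q 0%N) by rewrite mulr_ge0// subr_ge0; exact: ndq.
have := mulr_ge0 h1 h2; lra.
Qed.

End brownian.

(** * Increments of the generalized grey Brownian motion *)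

Section mittag_leffler.
Context (R : realType).
Local Notation mu := lebesgue_measure.

Lemma gammaV_ge0 (x : R) : 0 <= (gamma x)^-1.
Proof.
rewrite invr_ge0 /gamma; apply: Rintegral_ge0 => t _.
by rewrite mulr_ge0 ?powR_ge0 ?expR_ge0.
Qed.

(* If the integral diverges then [gamma x], hence its inverse, is [0]. *)
Lemma gammaV_le (x : R) : 1 <= x -> (gamma x)^-1 <= expR 2.
Proof.
move=> x1; rewrite /gamma /Rintegral.
set I := (\int[_]_(_ in _) _)%E.
have mf (D : set R) : measurable_fun D (fun t : R => (t `^ (x - 1) * expR (- t))%:E).
  apply/measurable_EFinP/measurable_funTS; apply: measurable_funM => //.
  by apply: measurableT_comp => //.
(* On [[1, 2]], an interval of length 1, the integrand is at least [expR (-2)], because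
   [t ^ (x - 1) >= 1] there. *)
have : ((expR (-2))%:E <= I)%E.
  apply: (@le_trans _ _ (\int[mu]_(t in `[1%R, 2%R]) (t `^ (x - 1) * expR (- t))%:E)%E).
    have -> : (expR (-2 : R))%:E = (\int[mu]_(t in `[1%R, 2%R]) (expR (-2 : R))%:E)%E.
      rewrite integral_cst//= lebesgue_measure_itv/= lte_fin ltr1n.
      by rewrite -EFinD -EFinM; congr EFin; lra.
    apply: ge0_le_integral => //.
    - exact: mf.
    - move=> t /=; rewrite in_itv/= => /andP[t1 t2].
      rewrite lee_fin -[leLHS]mul1r ler_pM ?expR_ge0//.
      - by rewrite -[leLHS](powRr0 t); apply: ler_powR => //; rewrite subr_ge0.
      - by rewrite ler_expR lerN2.
  apply: ge0_subset_integral => //.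
  - exact: mf.
  - by move=> t _; rewrite lee_fin mulr_ge0 ?powR_ge0 ?expR_ge0.
  - by move=> t /=; rewrite !in_itv/= andbT => /andP[t1 _]; rewrite (lt_le_trans _ t1).
case: I => [r| |]//=; last by rewrite invr0 expR_ge0.
rewrite lee_fin => h; rewrite -[expR 2]invrK -expRN lef_pV2 ?posrE ?expR_gt0//.
exact: lt_le_trans (expR_gt0 _) h.
Qed.

Lemma cvg_real_complex (u : nat -> R) (l : R) : u n @[n --> \oo] --> l ->
  (fun n => (u n)%:C : R[i]^o) n @[n --> \oo] --> (l%:C : R[i]^o).
Proof.
move=> /cvgrPdist_lt ul; apply/cvgrPdist_lt => -[e e'] /=.
(* A positive element of [R[i]] has zero imaginary part, so the radius is a positive real. *)
rewrite ltcE/= => /andP[/eqP -> e0].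
move: (ul _ e0); apply: filterS => n.
by rewrite -rmorphB normc_def/= expr0n addr0 sqrtr_sqr ltcR.
Qed.

Variable beta : R.
Hypothesis beta0 : 0 < beta.

Let a (q : R) (k : nat) : R := (- q) ^+ k * (gamma (beta * k%:R + 1))^-1.

Let gammaVbeta k : (gamma (beta * k%:R + 1))^-1 <= expR 2.
Proof. by apply: gammaV_le; rewrite lerDr mulr_ge0// ltW. Qed.

Let norm_a q k : 0 <= q -> `|a q k| <= geometric (expR 2) q k.
Proof.
move=> q0; rewrite normrM normrX normrN (ger0_norm q0) (ger0_norm (gammaV_ge0 _))//.
by rewrite mulrC /= ler_wpM2r ?exprn_ge0.
Qed.

Let cvg_a q : 0 <= q <= 2^-1 -> cvgn (series (a q)).
Proof.
move=> /andP[q0 q1]; apply: normed_cvg.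
apply: (@series_le_cvg _ _ (geometric (expR 2) q)) => //.
- by move=> n; exact: normr_ge0.
- by move=> n; rewrite /= mulr_ge0 ?expR_ge0 ?exprn_ge0.
- by move=> n; exact: norm_a.
- by apply: is_cvg_geometric_series; rewrite ger0_norm//; lra.
Qed.

Let mittag_lefflerE q : 0 <= q <= 2^-1 ->
  mittag_leffler beta (- q)%:C = (limn (series (a q)))%:C.
Proof.
move=> hq; rewrite /mittag_leffler; set u : nat -> R[i]^o := series _.
have -> : u = fun n => (series (a q) n)%:C : R[i]^o.
  apply/funext => n; rewrite /u /series /= rmorph_sum/=; apply: eq_bigr => k _.
  by rewrite /a rmorphM/= rmorphXn/= fmorphV.
exact: (cvg_lim (@norm_hausdorff _ R[i]^o) (cvg_real_complex (cvg_a hq))).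
Qed.

(** The terms of index 0 cancel. As the inverse gamma values are at most [expR 2], the term of index
    [k >= 1] is at most [expR 2 * q * 2^-(k-1)] in absolute value when [q <= 1/2], and these bounds
    sum to [2 * expR 2 * q]. *)
Lemma mittag_leffler_near0 (q : R) : 0 <= q <= 2^-1 ->
  complex.Re (mittag_leffler beta (0%:C)) -
  complex.Re (mittag_leffler beta (- q)%:C) <= 2 * expR 2 * q.
Proof.
move=> hq; move/andP: (hq) => [q0 q1].
rewrite -{1}oppr0 !mittag_lefflerE ?lexx ?invr_ge0//=.
have c0 : cvgn (series (a 0)) by apply: cvg_a; rewrite lexx/= invr_ge0.
rewrite -limB//; last exact: cvg_a.
apply: limr_le.
  by apply: is_cvgB => //; exact: cvg_a.
apply: nearW => n; change (series (a 0) n - series (a q) n <= 2 * expR 2 * q).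
case: n => [|n].
  by rewrite /series /= !big_geq// subrr !mulr_ge0 ?expR_ge0.
(* The factor [1 - 2^-n], from the partial sums of the geometric series, makes the bound
   inductive. *)
suff : series (a 0) n.+1 - series (a q) n.+1 <= 2 * expR 2 * q * (1 - 2^-1 ^+ n).
  move=> h; apply: (le_trans h); rewrite ler_piMr ?mulr_ge0 ?expR_ge0//.
elim: n => [|n IH].
  by rewrite !seriesEord/= !big_ord_recl !big_ord0 /a !expr0 !subrr ?mulr0.
rewrite !(seriesSr _ n.+1).
have -> : a 0 n.+1 = 0 by rewrite /a oppr0 exprS !mul0r.
have h1 : - a q n.+1 <= expR 2 * (q * 2^-1 ^+ n).
  apply: (le_trans (ler_norm _)); rewrite normrN; apply: (le_trans (norm_a _ q0)).
  rewrite /= ler_pM2l ?expR_gt0// exprS ler_wpM2l//.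
  by apply: lerXn2r; rewrite ?nnegrE ?invr_ge0.
have e2 := expR_ge0 (2 : R).
rewrite exprS; move: IH h1; set x := 2^-1 ^+ n.
set s1 := series _ _; set s2 := series _ _.
move: (a q _) => y; nra.
Qed.

End mittag_leffler.

Lemma bounded_integrable d (T : measurableType d) (R : realType)
    (P : probability T R) (f : T -> R) (M : R) :
  measurable_fun setT f -> (forall x, `|f x| <= M) ->
  P.-integrable setT (EFin \o f).
Proof.
move=> mf fM; apply: (@le_integrable _ _ _ _ _ measurableT _ (cst M%:E)).
- exact/measurable_EFinP.
- by move=> x _; rewrite /= lee_fin (le_trans (fM x))// ler_norm.
- exact: finite_measure_integrable_cst.
Qed.

Lemma integral_probability_cst d (T : measurableType d) (R : realType)
    (P : probability T R) (r : R) : (\int[P]_x r%:E = r%:E)%E.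
Proof.
by rewrite integral_cst// -[RHS]mule1; congr (_ * _)%E; exact: probability_setT.
Qed.

(** * Squares as limits of cosine quotients *)

Section cos_limit.
Context (R : realType).

(** With [u = harmonic n * y / 2], the identity [1 - cos (2 u) = 2 sin^2 u] makes the quotient equal
    to [y^2 (sin u / u)^2], and [sin u / u] tends to 1. *)
Lemma cvg_sqr_cos (y : R) :
  2 * (1 - cos (harmonic n * y)) / harmonic n ^+ 2 @[n --> \oo] --> y ^+ 2.
Proof.
have [->|y0] := eqVneq y 0.
  under eq_fun do rewrite mulr0 cos0 subrr mulr0 mul0r.
  by rewrite expr0n; exact: cvg_cst.
(* This limit is the derivative of [sin] at 0. *)
have sin_div : h^-1 * sin h @[h --> (0 : R)^'] --> (1 : R).
  have D : is_derive (0 : R) 1 sin (cos 0) by exact: is_derive_sin.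
  have := @ex_derive _ _ _ _ _ _ _ D; rewrite /derivable => /cvg_ex[l hl].
  have := @derive_val _ _ _ _ _ _ _ D; rewrite /derive (cvg_lim _ hl)// cos0 => l1.
  rewrite -l1; apply: cvg_trans hl; apply: near_eq_cvg; apply: nearW => h /=.
  by rewrite sin0 subr0 addr0 /GRing.scale/= mulr1.
pose u n : R := harmonic n * (y / 2).
have u0 n : u n != 0 by rewrite mulf_neq0 ?mulf_neq0 ?invr_eq0 ?pnatr_eq0.
have : u n @[n --> \oo] --> 0.
  by rewrite -[X in _ --> X](mul0r (y / 2)); apply: cvgMl; exact: cvg_harmonic.
move=> cu; have h : (u n)^-1 * sin (u n) @[n --> \oo] --> (1 : R).
  by move/cvgr_dnbhsP : sin_div; exact.
have : y ^+ 2 * ((u n)^-1 * sin (u n) * ((u n)^-1 * sin (u n))) @[n --> \oo]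
    --> y ^+ 2 * (1 * 1).
  by apply: cvgM; [exact: cvg_cst|exact: cvgM].
rewrite !mulr1.
apply: cvg_trans; apply: near_eq_cvg; apply: nearW => n /=.
pose h0 : R := harmonic n; rewrite -[n.+1%:R^-1]/h0.
have un : u n = h0 * (y / 2) by [].
have h00 : h0 != 0 by rewrite gt_eqF//= invr_gt0.
have -> : h0 * y = u n *+ 2 by rewrite -mulr_natr un; field.
rewrite cos_mulr2n cos2sin2 -mulr_natr.
have -> : (u n)^-1 = 2 / (h0 * y) by rewrite un; field; rewrite y0.
by field; rewrite h00 y0.
Qed.

End cos_limit.

(** * Second moments of the increments *)

Section ggBm_increments.
Context d (T : measurableType d) (R : realType) (P : probability T R).
Variables (beta alpha : R) (B : R -> {RV P >-> R}).
Hypotheses (beta0 : 0 < beta) (alpha0 : 0 < alpha) (hB : is_ggBm beta alpha B).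

(** The joint characteristic function at the times [s < t] is taken with coefficients [- th] and
    [th]. The powers of [s] and [t] cancel in the quadratic form, and the diagonal terms [0 ^ alpha]
    vanish because [alpha > 0]. *)
Lemma ggBm_increment_charfun (s t th : R) : 0 <= s -> s < t ->
  expectation_expi P (fun w => th * (B t w - B s w)) =
  mittag_leffler beta (- (2^-1 * th ^+ 2 * (t - s) `^ alpha))%:C.
Proof.
move=> s0 st.
pose tt (k : 'I_2) : R := if k == 0 then s else t.
pose theta : 'cV[R]_2 := \col_k (if k == 0 then - th else th).
have := @ggBm_charfun _ _ _ _ _ _ _ hB 2 tt theta isT _ _.
have -> : (fun w => \sum_(k < 2) theta k 0 * B (tt k) w) =
          (fun w => th * (B t w - B s w)).
  by apply/funext => w; rewrite !big_ord_recl big_ord0 /tt /= !mxE/=; ring.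
move=> ->.
- congr (mittag_leffler beta (_ %:C)).
  rewrite !mxE !big_ord_recl big_ord0 !mxE !big_ord_recl !big_ord0 !mxE/= /tt/=.
  rewrite !subrr normr0 powR0 ?gt_eqF// (distrC s t) (ger0_norm (_ : 0 <= t - s)).
    by field.
  by rewrite subr_ge0 ltW.
- by move=> k; rewrite /tt; case: ifP => // _; rewrite (le_trans s0)// ltW.
- by move=> [[|[|]]//= ?] [[|[|]]//= ?].
Qed.

(** The cosine quotients [h n], at frequency [harmonic n], tend pointwise to the squared increment
    and have means bounded uniformly in [n]; Fatou's lemma carries the bound to the limit. *)
Lemma ggBm_increment_sqr (s t : R) : 0 <= s -> s < t -> t <= 1 ->
  (\int[P]_x ((B t x - B s x) ^+ 2)%:E <= (2 * expR 2 * (t - s) `^ alpha)%:E)%E.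
Proof.
move=> s0 st t1.
pose D x := B t x - B s x.
have mD : measurable_fun setT D by exact: measurable_funB.
have ts : (t - s) `^ alpha <= 1.
  rewrite -(powRr0 (t - s)); apply: ger_powR; last exact: ltW.
  by rewrite subr_gt0 st/=; lra.
have mcos th : measurable_fun setT (fun x => cos (th * D x)).
  apply: measurableT_comp; last exact: measurable_funM.
  by apply: continuous_measurable_fun; exact: continuous_cos.
have icos th : P.-integrable setT (EFin \o (fun x => cos (th * D x))).
  by apply: (@bounded_integrable _ _ _ P _ 1) => [|x]; [exact: mcos|exact: cos_max].
have Ecos th : (\int[P]_x (cos (th * D x))%:E)%E =
    (complex.Re (mittag_leffler beta (- (2^-1 * th ^+ 2 * (t - s) `^ alpha))%:C))%:E.
  rewrite -(ggBm_increment_charfun _ s0 st)/= expectation.unlock fineK//.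
  by apply: integrable_fin_num => //; exact: icos.
(* The value at 0 is read off the characteristic function at frequency 0, where the cosine is 1. *)
have Ecos0 : complex.Re (mittag_leffler beta 0%:C) = 1.
  have := Ecos 0; under eq_integral do rewrite mul0r cos0.
  rewrite integral_probability_cst expr0n mulr0 mul0r oppr0.
  by move=> [<-].
pose h n x := 2 / harmonic n ^+ 2 * (1 - cos (@harmonic R n * D x)).
have h0 n x : 0 <= h n x.
  apply: mulr_ge0; first by rewrite divr_ge0// sqr_ge0.
  by rewrite subr_ge0 cos_le1.
have mh n : measurable_fun setT (EFin \o h n).
  by apply/measurable_EFinP; apply: measurable_funM => //; exact: measurable_funB.
have Eh n : (\int[P]_x (h n x)%:E <= (2 * expR 2 * (t - s) `^ alpha)%:E)%E.
  set th : R := harmonic n.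
  have th0 : 0 < th by rewrite /th/= invr_gt0.
  have th1 : th <= 1 by rewrite /th/= invf_le1// ler1n.
  under eq_integral do rewrite EFinM.
  rewrite -/th ge0_integralZl//; last 2 first.
  - by apply/measurable_EFinP; exact: measurable_funB.
  - by rewrite lee_fin divr_ge0// sqr_ge0.
  under eq_integral do rewrite EFinB.
  rewrite integralB//; last 2 first.
  - exact: finite_measure_integrable_cst.
  - exact: icos.
  rewrite integral_probability_cst Ecos -EFinB -EFinM lee_fin.
  (* The Mittag-Leffler estimate requires [q <= 1/2]; this follows from [th <= 1] and, through [ts],
     from [t <= 1]. *)
  set q := 2^-1 * th ^+ 2 * _.
  have q01 : 0 <= q <= 2^-1.
    have pt := powR_ge0 (t - s) alpha.
    have t2 : th ^+ 2 <= 1 by rewrite expr_le1// ltW.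
    have := mulr_ge0 (sqr_ge0 th) pt.
    have := ler_pM (sqr_ge0 th) pt t2 ts.
    by rewrite /q -mulrA; lra.
  move: (Ecos0) (mittag_leffler_near0 beta0 q01).
  move: (mittag_leffler beta) => M -> hq.
  apply: (le_trans (ler_wpM2l _ hq)); first by rewrite divr_ge0// sqr_ge0.
  by rewrite /q le_eqVlt; apply/orP; left; apply/eqP; field; rewrite gt_eqF.
have lim x : (h n x)%:E @[n --> \oo] --> ((D x) ^+ 2)%:E.
  apply: cvg_EFin; first exact: nearW.
  rewrite (_ : _ \o _ = fun n => 2 * (1 - cos (harmonic n * D x)) / harmonic n ^+ 2).
    exact: cvg_sqr_cos.
  by apply/funext => n; rewrite /= /h mulrAC.
have -> : (\int[P]_x ((B t x - B s x) ^+ 2)%:E =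
           \int[P]_x limn_einf (fun n => (h n x)%:E))%E.
  by apply: eq_integral => x _; rewrite (cvg_limn_einf_sup (lim x)).
apply: (le_trans (fatou _ _ _ _)) => //.
- by move=> n x _; rewrite lee_fin.
rewrite limn_einf_lim; apply: lime_le; first exact: is_cvg_einfs.
apply: nearW => n; apply: le_trans (Eh n).
by apply: ereal_inf_lbound; exists n => /=.
Qed.

End ggBm_increments.

(** * Dyadic quadratic variation *)

Section dyadic_variation.
Context (R : realType).

(** The minimum with 1 yields a point of the interval for every [k]; it is inactive for
    [k <= 2^n]. *)
Lemma dyadic_subproof n k : unit_interval R (Num.min 1 (k%:R / 2 ^+ n)).
Proof.
by rewrite /unit_interval/= in_itv/= le_min ler01 ge_min lexx divr_ge0// exprn_ge0.
Qed.

Definition dyadic n k : unit_interval R := SigSub (mem_set (dyadic_subproof n k)).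

Lemma val_dyadic n k : (k <= 2 ^ n)%N -> \val (dyadic n k) = k%:R / 2 ^+ n.
Proof.
move=> kn /=; apply/min_idPr.
by rewrite ler_pdivrMr ?exprn_gt0// mul1r -natrX ler_nat.
Qed.

Lemma measurable_eval (t : unit_interval R) :
  measurable_fun setT (fun w : C01 R => \val w t).
Proof.
move=> _ A mA; rewrite setTI; apply: sub_sigma_algebra.
exists 1%N, (fun=> t), (fun=> A); split => //.
by apply/seteqP; split => [w ? //|w /(_ ord0)].
Qed.

Definition dyadic_variation n (w : C01 R) : R :=
  \sum_(k < 2 ^ n) (\val w (dyadic n k.+1) - \val w (dyadic n k)) ^+ 2.

Lemma dyadic_variation_ge0 n w : 0 <= dyadic_variation n w.
Proof. by apply: sumr_ge0 => k _; rewrite sqr_ge0. Qed.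

Lemma measurable_dyadic_variation n : measurable_fun setT (dyadic_variation n).
Proof.
apply: measurable_sum => k; apply: measurable_funX.
by apply: measurable_funB; exact: measurable_eval.
Qed.

(** Stated through a sum in the extended reals, the event is the preimage of a point under a
    measurable function. On its complement the series converges, so its terms tend to 0. *)
Definition infinite_variation : set (C01 R) :=
  [set w | (\sum_(0 <= n <oo) (dyadic_variation n w)%:E = +oo)%E].

Lemma measurable_infinite_variation : measurable infinite_variation.
Proof.
have h : measurable_fun setT (fun w : C01 R =>
    \sum_(0 <= n <oo) (dyadic_variation n w)%:E)%E.
  apply: ge0_emeasurable_sum => [n w _ _|n _].
    by rewrite lee_fin dyadic_variation_ge0.
  by apply/measurable_EFinP; exact: measurable_dyadic_variation.
have := h measurableT _ (emeasurable_set1 +oo%E); rewrite setTI; exact.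
Qed.

Lemma dyadic_variation_cvg0 w : ~ infinite_variation w ->
  dyadic_variation n w @[n --> \oo] --> 0.
Proof.
move=> hw; apply: cvg_series_cvg_0.
set V := (\sum_(0 <= n <oo) (dyadic_variation n w)%:E)%E.
have V0 n : (0 <= (dyadic_variation n w)%:E)%E by rewrite lee_fin dyadic_variation_ge0.
have Vfin : V = (fine V)%:E.
  by rewrite fineK// ge0_fin_numE ?nneseries_ge0// ltey; apply/eqP.
apply: nondecreasing_is_cvgn.
  by apply: nondecreasing_series => n _ _; exact: dyadic_variation_ge0.
exists (fine V) => _ [n _ <-]; rewrite -lee_fin -Vfin /series/= -sumEFin.
exact: nneseries_lim_ge.
Qed.

End dyadic_variation.

(** * Summability for the generalized grey Brownian motion *)

Section ggBm_variation.
Context d (T : measurableType d) (R : realType) (P : probability T R).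
Variables (beta alpha : R) (B : R -> {RV P >-> R}) (Z : {mfun T >-> C01 R}).
Hypotheses (beta0 : 0 < beta) (alpha1 : 1 < alpha) (hB : is_ggBm beta alpha B).
Hypothesis hZ : is_path_of P B Z.

(** At level [n] there are [2^n] increments, each with second moment [O(2^(- n alpha))]. Hence this
    ratio, which is below 1 because [alpha > 1]. *)
Let r : R := 2 * 2 `^ (- alpha).

Let r01 : 0 <= r < 1.
Proof.
rewrite /r mulr_ge0 ?powR_ge0//= powRN ltr_pdivrMr ?powR_gt0// mul1r.
rewrite /powR pnatr_eq0/= -[ltLHS]lnK ?posrE// ltr_expR.
by rewrite -[ltLHS]mul1r ltr_pM2r// ln_gt0// ltr1n.
Qed.

Let variation_le n :
  (\int[P]_x (dyadic_variation n (Z x))%:E <= (geometric (2 * expR 2) r n)%:E)%E.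
Proof.
have -> : (\int[P]_x (dyadic_variation n (Z x))%:E =
  \int[P]_x \sum_(k < 2 ^ n)
    ((B (k.+1%:R / 2 ^+ n) x - B (k%:R / 2 ^+ n) x) ^+ 2)%:E)%E.
  apply: ge0_ae_eq_integral => //.
  - apply/measurable_EFinP.
    by apply: measurableT_comp => //; exact: measurable_dyadic_variation.
  - apply: emeasurable_sum => k; apply/measurable_EFinP; apply: measurable_funX.
    exact: measurable_funB.
  - by move=> x _; rewrite lee_fin dyadic_variation_ge0.
  - by move=> x _; apply: sume_ge0 => k _; rewrite lee_fin sqr_ge0.
  - apply: filterS hZ => x hx _; rewrite sumEFin; congr EFin.
    apply: eq_bigr => k _; rewrite !hx !val_dyadic//; exact: ltnW.
rewrite ge0_integral_sum//; last 2 first.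
- by move=> k; apply/measurable_EFinP; apply: measurable_funX; exact: measurable_funB.
- by move=> k x _; rewrite lee_fin sqr_ge0.
apply: (@le_trans _ _ (\sum_(k < 2 ^ n) (2 * expR 2 * (2 `^ (- alpha)) ^+ n)%:E)%E).
  apply: lee_sum => k _.
  have p2 : 0 < 2 ^+ n :> R by rewrite exprn_gt0.
  have := @ggBm_increment_sqr _ _ _ _ _ _ _ beta0 (lt_trans ltr01 alpha1) hB
    (k%:R / 2 ^+ n) (k.+1%:R / 2 ^+ n).
  rewrite -mulrBl -natrB// subSnn mul1r => /(_ _ _ _)/le_trans; apply.
  - by rewrite divr_ge0// ltW.
  - by rewrite ltr_pM2r ?invr_gt0// ltr_nat.
  - by rewrite ler_pdivrMr// mul1r -natrX ler_nat.
  - rewrite lee_fin ler_wpM2l ?mulr_ge0 ?expR_ge0//.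
    rewrite -!powR_mulrn ?powR_ge0// -[X in X `^ alpha]powR_inv1 ?powR_ge0//.
    by rewrite -!powRrM le_eqVlt; apply/orP; left; apply/eqP; congr (_ `^ _); ring.
rewrite sumEFin lee_fin sumr_const card_ord /= /r exprMn -[leLHS]mulr_natl natrX.
by rewrite le_eqVlt; apply/orP; left; apply/eqP; ring.
Qed.

(** By monotone convergence the mean of the sum is the sum of the means, which is dominated by a
    convergent geometric series; an integrable function is almost everywhere finite. *)
Lemma ggBm_finite_variation : distribution P Z (infinite_variation (R := R)) = 0%E.
Proof.
pose f x := (\sum_(0 <= n <oo) (dyadic_variation n (Z x))%:E)%E.
have mV n : measurable_fun setT (EFin \o (fun x => dyadic_variation n (Z x))).
  apply/measurable_EFinP.
  by apply: measurableT_comp => //; exact: measurable_dyadic_variation.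
have V0 n x : (0 <= (dyadic_variation n (Z x))%:E)%E.
  by rewrite lee_fin dyadic_variation_ge0.
have mf : measurable_fun setT f.
  by apply: ge0_emeasurable_sum => [n x _ _|n _]; [exact: V0|exact: mV].
have f0 x : (0 <= f x)%E by apply: nneseries_ge0.
have fi : P.-integrable setT f.
  apply/integrableP; split => //.
  under eq_integral do rewrite gee0_abs//.
  rewrite integral_nneseries//.
  apply: (@le_lt_trans _ _ (\sum_(0 <= n <oo) (geometric (2 * expR 2) r n)%:E)%E).
    apply: lee_nneseries => [n _ _|n _]; last exact: variation_le.
    exact: integral_ge0.
  have /andP[r0 r1] := r01.
  have cg : cvgn (series (geometric (2 * expR 2) r)).
    by apply: is_cvg_geometric_series; rewrite ger0_norm.
  have g0 n : 0 <= geometric (2 * expR 2) r n.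
    by apply: geometric_ge0 => //; rewrite mulr_ge0 ?expR_ge0.
  apply: (@le_lt_trans _ _ (limn (series (geometric (2 * expR 2) r)))%:E);
    last exact: ltry.
  apply: lime_le; first by apply: is_cvg_nneseries => n _ _; rewrite lee_fin.
  apply: nearW => n; rewrite sumEFin lee_fin.
  by apply: nondecreasing_cvgn_le => //; exact: nondecreasing_series.
have := integrable_ae measurableT fi => -[N [mN N0 fN]].
apply/eqP; rewrite eq_le measure_ge0 andbT -N0.
apply: (@le_measure _ _ _ P (Z @^-1` _)); rewrite ?inE//.
  exact: (measurable_funPTI Z (measurable_infinite_variation (R := R))).
move=> x fx; apply: fN => /= /(_ Logic.I).
by rewrite /f fx.
Qed.

End ggBm_variation.

(** * The time-changed Brownian motion *)

Section laplace.
Context d (T : measurableType d) (R : realType) (P : probability T R).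

(** For fixed [l], [expR (- l * V n x)] tends to 1 on [F], so Fatou's lemma bounds [P F] by any
    bound on the Laplace transforms at [l] that is uniform in [n]. Letting [r] grow makes this bound
    tend to 0. *)
Lemma null_cvg0_laplace (V : nat -> T -> R) (F : set T) (K : R) :
  (forall n, measurable_fun setT (V n)) -> (forall n x, 0 <= V n x) ->
  measurable F -> (forall x, F x -> V n x @[n --> \oo] --> 0) ->
  (forall r : nat, exists2 l : R, 0 <= l & forall n,
    (\int[P]_x (expR (- l * V n x))%:E <= (K * 2^-1 ^+ r)%:E)%E) ->
  P F = 0%E.
Proof.
move=> mV V0 mF VF laplace.
have PF r : (P F <= (K * 2^-1 ^+ r)%:E)%E.
  have [l l0 Vl] := laplace r.
  have mexp D n : measurable_fun D (fun x => (expR (- l * V n x))%:E).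
    apply/measurable_funTS/measurable_EFinP; apply: measurableT_comp => //.
    exact: measurable_funM.
  have lim x : F x -> (expR (- l * V n x))%:E @[n --> \oo] --> 1%E.
    move=> Fx; apply: cvg_EFin; first exact: nearW.
    rewrite /comp/= -(@expR0 R) -(mulr0 (- l)).
    apply: continuous_cvg; first exact: continuous_expR.
    by apply: cvgM; [exact: cvg_cst|exact: VF].
  have -> : P F = (\int[P]_(x in F) limn_einf (fun n => (expR (- l * V n x))%:E))%E.
    rewrite (eq_integral (cst 1%E)); first by rewrite integral_cst// mul1e.
    by move=> x /set_mem Fx; rewrite (cvg_limn_einf_sup (lim x Fx)).
  apply: (le_trans (fatou _ _ _ _)) => //.
  rewrite limn_einf_lim; apply: lime_le; first exact: is_cvg_einfs.
  apply: nearW => n; apply: le_trans (Vl n).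
  apply: (@le_trans _ _ (\int[P]_(x in F) (expR (- l * V n x))%:E)%E).
    by apply: ereal_inf_lbound; exists n => /=.
  by apply: ge0_subset_integral => // x _; rewrite lee_fin expR_ge0.
have PFE : P F = (fine (P F))%:E by rewrite fineK// fin_num_measure.
rewrite PFE; congr EFin; apply/eqP; rewrite eq_le fine_ge0// andbT.
have cK : K * 2^-1 ^+ r @[r --> \oo] --> 0.
  by apply: (@cvg_geometric R K 2^-1); rewrite ger0_norm; lra.
rewrite -(cvg_lim _ cK)//; apply: limr_ge; first by apply/cvg_ex; exists 0.
by apply: nearW => r; rewrite -lee_fin -PFE.
Qed.

End laplace.

(** * First passage times counted on a dyadic grid *)

Section counting.
Context (R : realType).

(* With the points [j / 2^m], [j < m 2^m], this is [2^m] times an approximation of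
   the first passage time of [f] above [t]. *)
Definition passage_count (f : R -> R) (m : nat) (t : R) : nat :=
  \sum_(j < m * 2 ^ m) (f (j%:R / 2 ^+ m) <= t)%R.

Definition passage_approx (f : R -> R) (m : nat) (t : R) : R :=
  (passage_count f m t)%:R / 2 ^+ m.

Lemma passage_count_le f m t : (passage_count f m t <= m * 2 ^ m)%N.
Proof.
rewrite -[leqRHS]card_ord -sum1_card; apply: leq_sum => j _; exact: leq_b1.
Qed.

Lemma passage_count_homo f m : {homo passage_count f m : s t / s <= t >-> (s <= t)%N}.
Proof.
move=> s t st; apply: leq_sum => j _.
by case: leP => // fs; rewrite (le_trans fs st).
Qed.

Lemma passage_approx_homo f m : {homo passage_approx f m : s t / s <= t}.
Proof.
move=> s t st; rewrite /passage_approx ler_pM2r ?invr_gt0 ?exprn_gt0//.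
by rewrite ler_nat; exact: passage_count_homo.
Qed.

Lemma passage_approx_ge0 f m t : 0 <= passage_approx f m t.
Proof. by rewrite divr_ge0. Qed.

Lemma leq_count_ord (p : nat -> bool) (M K : nat) :
  (forall j, p j -> (j < K)%N) -> (\sum_(j < M) (p j : nat) <= K)%N.
Proof.
move=> pK; rewrite -(big_mkord xpredT (fun j => p j : nat)).
elim: M => [|M IH]; first by rewrite big_geq.
rewrite big_nat_recr//=; have [pM|] := boolP (p M); last by rewrite addn0.
rewrite addn1; apply: leq_ltn_trans (pK _ pM).
rewrite -[leqRHS]subn0 -[leqRHS]muln1 -sum_nat_const_nat.
by apply: leq_sum => j _; exact: leq_b1.
Qed.

Lemma geq_count_ord (p : nat -> bool) (M K : nat) :
  (K <= M)%N -> (forall j, (j < K)%N -> p j) -> (K <= \sum_(j < M) (p j : nat))%N.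
Proof.
move=> KM pK; rewrite -(big_mkord xpredT (fun j => p j : nat)) (@big_cat_nat _ _ _ K)//=.
apply: (leq_trans _ (leq_addr _ _)).
rewrite -[leqLHS]subn0 -[leqLHS]muln1 -sum_nat_const_nat.
rewrite [leqLHS]big_nat [leqRHS]big_nat.
by apply: leq_sum => j /andP[_ jK]; rewrite pK.
Qed.

(** Grid points before the passage time [u] are counted and those after it are not, so the count
    lies between the integer part of [u * 2^m] and that integer plus 1. The point [s0 <= m] above
    level [t] places [u] within the range of the grid. *)
Lemma passage_approx_near (f : R -> R) (t s0 : R) m :
  (forall s s', 0 <= s -> s <= s' -> f s <= f s') ->
  0 <= s0 <= m%:R -> t < f s0 ->
  `|passage_approx f m t - inf [set s | 0 <= s /\ t < f s]| <= 2^-1 ^+ m.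
Proof.
move=> ndf /andP[s00 s0m] ts0; set A := [set s | _]; set u := inf A.
have iA : has_inf A.
  by split; [exists s0|exists 0 => x -[]].
have u0 : 0 <= u by apply: lb_le_inf; [exists s0|move=> x []].
have us0 : u <= s0 by apply: ge_inf => //; exact: iA.2.
have p0 : 0 < 2 ^+ m :> R by rewrite exprn_gt0.
set v := u * 2 ^+ m.
have v0 : 0 <= v by rewrite mulr_ge0// ltW.
have /andP[fl1 fl2] := truncn_itv v0; set K := Num.truncn v in fl1 fl2.
have C1 : (passage_count f m t <= K.+1)%N.
  apply: (@leq_count_ord (fun j => f (j%:R / 2 ^+ m) <= t)) => j fj.
  rewrite ltnS leqNgt; apply/negP => Kj.
  have uj : u < j%:R / 2 ^+ m.
    rewrite ltr_pdivlMr// (lt_le_trans fl2)// ler_nat//.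
  have [s [s0' fs] sj] := inf_lt iA.1 uj.
  have := ndf _ _ s0' (ltW sj); move: fj fs; lra.
have C2 : (K <= passage_count f m t)%N.
  apply: (@geq_count_ord (fun j => f (j%:R / 2 ^+ m) <= t)).
    rewrite -(ler_nat R) natrM natrX (le_trans fl1)// ler_pM2r//.
    exact: le_trans us0 s0m.
  move=> j jK; rewrite leNgt; apply/negP => fj.
  have : u <= j%:R / 2 ^+ m.
    by apply: ge_inf; [exact: iA.2|split => //; rewrite divr_ge0// ltW].
  rewrite ler_pdivlMr// -/v => /(le_trans fl1); rewrite ler_nat.
  by rewrite leqNgt jK.
have -> : passage_approx f m t - u = ((passage_count f m t)%:R - v) / 2 ^+ m.
  by rewrite /passage_approx mulrBl /v mulfK// gt_eqF.
rewrite normrM (gtr0_norm (_ : 0 < (2 ^+ m)^-1)) ?invr_gt0// exprVn.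
rewrite -[leRHS]mul1r ler_pM2r ?invr_gt0//.
move: C1 C2; rewrite -!(ler_nat R) -natr1 ler_norml => C1 C2.
move: fl2; rewrite -natr1 => fl2; apply/andP; split; lra.
Qed.

(* The grid points [j / 2^m] with [0 < j / 2^m <= 2^-r] are counted at level [1] but
   not at level [0]. *)
Lemma passage_approx_jump (f : R -> R) (r m : nat) :
  f 0 = 0 -> (forall s t, 0 <= s -> s < t -> f s < f t) ->
  f (2^-1 ^+ r) <= 1 -> (r <= m)%N -> (2 <= m)%N ->
  2^-1 ^+ r <= passage_approx f m 1 - passage_approx f m 0.
Proof.
move=> f0 fi fr rm m2; rewrite /passage_approx -mulrBl ler_pdivlMr ?exprn_gt0//.
have p0 k : 0 < 2 ^+ k :> R by rewrite exprn_gt0.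
have fh s t : 0 <= s -> s <= t -> f s <= f t.
  by move=> s0; rewrite le_eqVlt => /predU1P[->//|/(fi _ _ s0)/ltW].
(* [J] is the index of the grid point [2^-r]. *)
pose J := (2 ^ (m - r))%N.
have JE : 2^-1 ^+ r * 2 ^+ m = J%:R :> R.
  rewrite natrX exprVn -{1}(subnKC rm) exprD mulrA mulVf ?mul1r// gt_eqF//.
rewrite JE.
(* The grid must contain the point of index [J] itself; for [r = 0] this is where [2 <= m] is
   used. *)
have JM : (J < m * 2 ^ m)%N.
  apply: (@leq_ltn_trans (2 ^ m)); first by rewrite leq_exp2l// leq_subr.
  by rewrite -[ltnLHS]mul1n ltn_pmul2r// expn_gt0.
(* By strict monotonicity only the index 0 is counted at level 0, whereas the [J + 1] indices up to
   [J] are counted at level 1. *)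
have C0 : (passage_count f m 0 <= 1)%N.
  apply: (@leq_count_ord (fun j => f (j%:R / 2 ^+ m) <= 0)) => -[|j]// fj.
  have : 0 < j.+1%:R / 2 ^+ m :> R by rewrite divr_gt0.
  by move=> /(fi _ _ (lexx 0)); rewrite f0; move: fj; lra.
have C1 : (J.+1 <= passage_count f m 1)%N.
  apply: (@geq_count_ord (fun j => f (j%:R / 2 ^+ m) <= 1)) => // j.
  rewrite ltnS => jJ; apply: le_trans fr; apply: fh; first by rewrite divr_ge0// ltW.
  by rewrite ler_pdivrMr// JE ler_nat.
by move: C0 C1; rewrite -!(ler_nat R) -natr1; lra.
Qed.

End counting.

(** * Measurability with respect to a process *)

Section process_sigma_algebra.
Context d (T : measurableType d) (R : realType) (P : probability T R).
Variable Y : R -> {RV P >-> R}.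

(** The generators of [process_sigma_algebra], named so that [g_sigma_algebraType] turns that
    σ-algebra into a measurable type. *)
Definition process_events : set (set T) :=
  [set E | exists t (A : set R), [/\ 0 <= t, measurable A & E = Y t @^-1` A]].

Lemma process_sigma_algebra_measurable E :
  process_sigma_algebra Y E -> measurable E.
Proof.
move: E; apply: smallest_sub; first exact: sigma_algebra_measurable.
by move=> _ [t [A [t0 mA ->]]]; exact: measurable_funPTI.
Qed.

Lemma measurable_process t : 0 <= t ->
  measurable_fun [set: g_sigma_algebraType process_events] (Y t).
Proof.
move=> t0 _ A mA; rewrite setTI; apply: sub_sigma_algebra.
by exists t, A.
Qed.

Lemma process_sigma_algebra_preimage (f : T -> R) A :
  measurable_fun [set: g_sigma_algebraType process_events] f -> measurable A ->
  process_sigma_algebra Y (f @^-1` A).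
Proof. by move=> mf mA; have := mf measurableT _ mA; rewrite setTI. Qed.

End process_sigma_algebra.

Section partition.
Context d (T : measurableType d) (R : realType) (mu : {measure set T -> \bar R}).
Local Open Scope ereal_scope.

(** Comparison cell by cell, where the cells are the fibres of [c]; this takes the place of
    conditioning on [c]. *)
Lemma ge0_le_integral_finpartition (I : finType) (c : T -> I) (f g : T -> \bar R) :
  (forall i, measurable (c @^-1` [set i])) ->
  measurable_fun setT f -> (forall x, 0 <= f x) ->
  measurable_fun setT g -> (forall x, 0 <= g x) ->
  (forall i, \int[mu]_(x in c @^-1` [set i]) f x <=
             \int[mu]_(x in c @^-1` [set i]) g x) ->
  \int[mu]_x f x <= \int[mu]_x g x.
Proof.
move=> mc mf f0 mg g0 fg.
have cT : [set: T] = \big[setU/set0]_(i <- enum I) (c @^-1` [set i]).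
  apply/seteqP; split => // x _.
  by rewrite -bigcup_seq; exists (c x) => //=; rewrite mem_enum.
have cI : trivIset [set` enum I] (fun i => c @^-1` [set i]).
  by move=> i j _ _ [x [/= <- <-]].
rewrite cT !ge0_integral_bigsetU ?enum_uniq//; last 2 first.
- exact: measurable_funTS.
- exact: measurable_funTS.
exact: lee_sum.
Qed.

End partition.

Section passage_measurable.
Context d (T : measurableType d) (R : realType) (P : probability T R).
Variable S : R -> {RV P >-> R}.

Lemma measurable_passage_count m t :
  measurable_fun [set: g_sigma_algebraType (process_events S)]
    (fun x => (passage_count (fun s => S s x) m t)%:R : R).
Proof.
under eq_fun do rewrite natr_sum.
apply: measurable_sum => j.
rewrite (_ : (fun x => _) = \1_(S (j%:R / 2 ^+ m) @^-1` `]-oo, t])).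
  apply: measurable_indic.
  have j0 : 0 <= j%:R / 2 ^+ m :> R by rewrite divr_ge0.
  have := measurable_process (Y := S) j0 measurableT (measurable_itv `]-oo, t]).
  by rewrite setTI.
apply/funext => x; rewrite indicE; congr (nat_of_bool _)%:R.
by apply/idP/idP; rewrite inE/= in_itv.
Qed.

Lemma passage_count_event m t n :
  process_sigma_algebra S [set x | passage_count (fun s => S s x) m t = n].
Proof.
rewrite (_ : [set x | _] =
    (fun x => (passage_count (fun s => S s x) m t)%:R : R) @^-1` [set n%:R]).
  by apply: process_sigma_algebra_preimage; first exact: measurable_passage_count.
apply/seteqP; split => x /= [].
  by move=> ->.
by move=> /eqP; rewrite eqr_nat => /eqP.
Qed.

End passage_measurable.

(** * Brownian motion at approximate passage times *)

Section laplace_passage.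
Context d (T : measurableType d) (R : realType) (P : probability T R).
Variables (W S : R -> {RV P >-> R}).
Hypotheses (hW : is_brownian_motion W) (hWS : independent_processes W S).

Let U m t x : R := passage_approx (fun s => S s x) m t.

Lemma measurable_passage_approx m t : measurable_fun setT (U m t).
Proof.
apply: measurable_funM => //.
move=> _ A mA; rewrite setTI; apply: (@process_sigma_algebra_measurable _ _ _ P S).
by apply: process_sigma_algebra_preimage; first exact: measurable_passage_count.
Qed.

Lemma measurable_sqrtV_passage_approx (l : R) m s t : 0 <= l -> s <= t ->
  measurable_fun setT (fun x => (Num.sqrt (1 + 2 * l * (U m t x - U m s x)))^-1).
Proof.
move=> l0 st.
rewrite (_ : (fun x => _) = fun x =>
    (1 + 2 * l * (U m t x - U m s x)) `^ (- 2^-1)).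
  apply: (measurableT_comp (measurable_powR _)); apply: measurable_funD => //.
  apply: measurable_funM => //.
  by apply: measurable_funB; exact: measurable_passage_approx.
apply/funext => x; rewrite powRN powR12_sqrt//.
have : 0 <= U m t x - U m s x by rewrite subr_ge0; exact: passage_approx_homo.
by move=> /(mulr_ge0 l0); lra.
Qed.

(** The count takes finitely many values, so the motion at the random time is a finite sum of its
    values at fixed times, weighted by indicators. *)
Lemma measurable_time_changed m t : measurable_fun setT (fun x => W (U m t x) x).
Proof.
pose F j := [set x | passage_count (fun s => S s x) m t = j].
have mF j : measurable (F j).
  by apply: process_sigma_algebra_measurable; exact: passage_count_event.
rewrite (_ : (fun x => _) = fun x => \sum_(j < (m * 2 ^ m).+1)
    \1_(F j) x * W (j%:R / 2 ^+ m) x).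
  apply: measurable_sum => j; apply: measurable_funM; last by [].
  exact/measurable_indic/mF.
apply/funext => x.
have jM : (passage_count (fun s => S s x) m t < (m * 2 ^ m).+1)%N.
  by rewrite ltnS passage_count_le.
rewrite (bigD1 (Ordinal jM))//= big1 => [|j jj].
  by rewrite indicE mem_set// mul1r addr0.
rewrite indicE memNset ?mul0r// => /= jE.
by move/eqP : jj; apply; apply: val_inj.
Qed.

(** Once the counts at all the levels [tau k] are fixed, the passage times are constants. Such a
    cell is an event of [S], hence independent of [W], so the bound for deterministic times holds on
    it with the factor given by its probability. *)
Lemma laplace_passage (l : R) (N m : nat) (tau : nat -> R) :
  0 <= l -> nondecreasing_seq tau ->
  (\int[P]_x (expR (- l * \sum_(k < N)
      (W (U m (tau k.+1) x) x - W (U m (tau k) x) x) ^+ 2))%:E <=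
   \int[P]_x ((Num.sqrt (1 + 2 * l * (U m (tau N) x - U m (tau 0%N) x)))^-1)%:E)%E.
Proof.
move=> l0 ndtau.
pose M := (m * 2 ^ m)%N.
(* The vector of all counts; [inord] never falls back on its default, as each count is at most
   [M]. *)
pose c x : {ffun 'I_N.+1 -> 'I_M.+1} :=
  [ffun k : 'I_N.+1 => inord (passage_count (fun s => S s x) m (tau k))].
have cE i x : c x = i <->
    forall k : 'I_N.+1, passage_count (fun s => S s x) m (tau k) = i k.
  split=> [<- k|ci]; first by rewrite ffunE inordK// ltnS passage_count_le.
  by apply/ffunP => k; rewrite ffunE ci inord_val.
have cS i : process_sigma_algebra S (c @^-1` [set i]).
  rewrite (_ : c @^-1` _ = \bigcap_(k : 'I_N.+1)
      [set x | passage_count (fun s => S s x) m (tau k) = i k]).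
    apply: (@fin_bigcap_measurable _ (g_sigma_algebraType (process_events S))) => // k _.
    exact: passage_count_event.
  apply/seteqP; split => x /=; first by move/cE => ci k _; exact: ci.
  by move=> ci; apply/cE => k; exact: ci.
have mc i : measurable (c @^-1` [set i]).
  exact: process_sigma_algebra_measurable (cS i).
apply: (ge0_le_integral_finpartition mc) => //.
- apply/measurable_EFinP; apply: measurableT_comp => //; apply: measurable_funM => //.
  apply: measurable_sum => k; apply: measurable_funX.
  by apply: measurable_funB; exact: measurable_time_changed.
- apply/measurable_EFinP; apply: measurable_sqrtV_passage_approx => //.
  exact: ndtau.
- move=> i; have [->|/set0P[y cy]] := eqVneq (c @^-1` [set i]) set0.
    by rewrite !integral_set0.
(* Any point [y] of the cell provides the constant values that the passage times take there. *)
pose q k := U m (tau k) y.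
have Uq x k : (c @^-1` [set i]) x -> (k <= N)%N -> U m (tau k) x = q k.
  move=> /= cx kN; have kN1 : (k < N.+1)%N by [].
  move/cE: cx => /(_ (Ordinal kN1)) /= cx; move/cE: cy => /(_ (Ordinal kN1)) /= cy.
  by rewrite /q /U /passage_approx cx cy.
pose D x := \sum_(k < N) (W (q k.+1) x - W (q k) x) ^+ 2.
rewrite (eq_integral (fun x => (expR (- l * D x))%:E)); last first.
  move=> x /set_mem cx; congr (expR (_ * _))%:E; apply: eq_bigr => k _.
  by rewrite !(Uq x)//; exact: ltnW.
rewrite [leRHS](eq_integral
  (fun=> ((Num.sqrt (1 + 2 * l * (q N - q 0%N)))^-1)%:E)); last first.
  by move=> x /set_mem cx; rewrite !(Uq x).
have q0 k : 0 <= q k by exact: passage_approx_ge0.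
have mD : measurable_fun [set: g_sigma_algebraType (process_events W)] D.
  apply: measurable_sum => k; apply: measurable_funX.
  by apply: measurable_funB; exact: measurable_process.
have mDT : measurable_fun setT D.
  apply: measurable_sum => k; apply: measurable_funX; exact: measurable_funB.
rewrite (@indep_integral_indic _ _ _ P _ D (fun z => expR (- l * z)))//.
- rewrite integral_cst// muleC; apply: lee_wpmul2r => //.
  apply: integral_expR_quadratic_variation => //.
  by move=> a b ab; apply: passage_approx_homo; exact: ndtau.
- by apply: measurableT_comp => //; exact: measurable_funM.
- move=> A mA; rewrite setIC muleC; apply: hWS => //.
  exact: process_sigma_algebra_preimage.
Qed.

End laplace_passage.

(** * Tail estimates for the stable subordinator *)

Section subordinator.
Context d (T : measurableType d) (R : realType) (P : probability T R).
Variables (beta : R) (S : R -> {RV P >-> R}).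
Hypothesis hS : is_stable_subordinator beta S.

Lemma subordinator_homo : {ae P, forall x,
  S 0 x = 0 /\ forall s t, 0 <= s -> s < t -> S s x < S t x}.
Proof.
apply: filterS2 (sub_starts_at_0 hS) (sub_strictly_increasing hS).
by move=> x S0 Sx; split.
Qed.

(** At [theta = 1] the power [theta ^ beta] is 1, so the estimates below do not involve [beta]. *)
Lemma subordinator_laplace1 t : 0 <= t ->
  (\int[P]_x (expR (- S t x))%:E = (expR (- t))%:E)%E.
Proof.
move=> t0; have := sub_laplace hS ltr01 t0.
rewrite powR1 mulr1 expectation.unlock => <-.
by apply: eq_integral => x _; rewrite mulN1r.
Qed.

Let mexp t : measurable_fun setT (fun x => (expR (- S t x))%:E).
Proof.
by apply/measurable_EFinP; apply: measurableT_comp => //; exact: measurable_funN.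
Qed.

Let mle t c : measurable [set x | S t x <= c].
Proof.
have := measurable_funPTI (S t) (measurable_itv `]-oo, c]).
by congr measurable; apply/seteqP; split => x /=; rewrite in_itv.
Qed.

(** Since [expR (-1) <= 1/2], one has [expR (- S t) <= 1/2 + 1/2 * \1_A]. Taking means gives
    [P(S t > 1) <= 2 (1 - expR (- t)) <= 2 t]. *)
Lemma subordinator_tail t : 0 <= t -> (P [set x | (1 < S t x)%R] <= (2 * t)%:E)%E.
Proof.
move=> t0; pose A := [set x | S t x <= 1].
have -> : [set x | 1 < S t x] = ~` A.
  apply/seteqP; split => x /=; last by move/negP; rewrite -ltNge.
  by move=> h /(lt_le_trans h); rewrite ltxx.
have mA : measurable A by exact: mle.
rewrite probability_setC//.
have : (\int[P]_x (expR (- S t x))%:E <=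
    \int[P]_x ((2^-1)%:E + 2^-1%:E * (\1_A x)%:E))%E.
  apply: ae_ge0_le_integral => //.
  - by move=> x _; rewrite -EFinM -EFinD lee_fin addr_ge0// mulr_ge0.
  - apply/measurable_EFinP; apply: measurable_funD => //; apply: measurable_funM => //.
  apply: filterS subordinator_homo => x [S0 Sx] _.
  rewrite -EFinM -EFinD lee_fin indicE.
  have St0 : 0 <= S t x.
    by move: t0; rewrite le0r => /predU1P[->|t0]; [rewrite S0|rewrite -S0; exact/ltW/Sx].
  have [/set_mem /= St1|/negP] := boolP (x \in A).
    rewrite mulr1 (_ : 2^-1 + 2^-1 = 1); last by field.
    by rewrite -expR0 ler_expR; lra.
  rewrite inE /A/= => /negP; rewrite -ltNge => St1; rewrite mulr0 addr0.
  apply: (@le_trans _ _ (expR (-1))); first by rewrite ler_expR; lra.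
  by rewrite expRN lef_pV2 ?posrE ?expR_gt0//; have := expR_ge1Dx (1 : R); lra.
rewrite subordinator_laplace1// ge0_integralD//; last first.
  by apply/measurable_EFinP; apply: measurable_funM.
rewrite integral_probability_cst ge0_integralZl_EFin//; last first.
  by apply/measurable_EFinP.
have PA : P A = (fine (P A))%:E by rewrite fineK// fin_num_measure.
rewrite integral_indic// setIT -[X in (_ + _ * X)%E]/(P A) PA.
rewrite -EFinM -EFinD -EFinB !lee_fin => h.
by have := expR_ge1Dx (- t); lra.
Qed.

(** A Chernoff bound gives [P(S n <= 1) <= expR (1 - n)], which tends to 0. Consequently the set
    whose infimum defines [inverse_process] is almost surely nonempty at all levels up to 1. *)
Lemma subordinator_exceeds : {ae P, forall x, exists n : nat, 1 < S n%:R x}.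
Proof.
pose A n := [set x | S n%:R x <= 1].
have mA n : measurable (A n) by exact: mle.
have PA n : (P (A n) <= (expR (1 - n%:R))%:E)%E.
  have -> : P (A n) = (\int[P]_x (\1_(A n) x)%:E)%E by rewrite integral_indic// setIT.
  apply: (@le_trans _ _ (\int[P]_x ((expR 1)%:E * (expR (- S n%:R x))%:E))%E).
    apply: ge0_le_integral => //.
    - by apply/measurable_EFinP.
    - by apply: emeasurable_funM.
    move=> x _; rewrite -EFinM lee_fin -expRD indicE.
    have [/set_mem /= Sn|_] := boolP (x \in A n); last exact: expR_ge0.
    have {}Sn : S n%:R x <= 1 := Sn; by rewrite -[leLHS]expR0 ler_expR; lra.
  rewrite ge0_integralZl_EFin ?expR_ge0//.
  by rewrite subordinator_laplace1// -EFinM -expRD.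
pose N := \bigcap_n A n.
have mN : measurable N by exact: bigcapT_measurable.
exists N; split => //.
  have PN : P N = (fine (P N))%:E by rewrite fineK// fin_num_measure.
  rewrite PN; congr EFin; apply/eqP; rewrite eq_le fine_ge0// andbT.
  have ce : expR (1 - n%:R) @[n --> \oo] --> (0 : R).
    rewrite (_ : (fun n => _) = geometric (expR 1) (expR (-1 : R))).
      apply: cvg_geometric; rewrite ger0_norm ?expR_ge0//. 
    by apply/funext => n; rewrite /= -expRM_natr -expRD mulN1r.
  rewrite -(cvg_lim _ ce)//; apply: limr_ge; first by apply/cvg_ex; exists 0.
  apply: nearW => n; rewrite -lee_fin -PN; apply: le_trans (PA n).
  by apply: le_measure; rewrite ?inE//; exact: bigcap_inf.
move=> x /= nx n _; rewrite /A/= leNgt; apply/negP => Sn; apply: nx; by exists n.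
Qed.

End subordinator.

Lemma cvg_passage_approx (R : realType) (f : R -> R) (t s0 : R) :
  (forall s s', 0 <= s -> s <= s' -> f s <= f s') -> 0 <= s0 -> t < f s0 ->
  passage_approx f m t @[m --> \oo] --> inf [set s | 0 <= s /\ t < f s].
Proof.
move=> ndf s00 ts0; apply/cvgrPdist_le => e e0.
have : (2^-1 : R) ^+ m @[m --> \oo] --> (0 : R).
  by apply: cvg_expr; rewrite ger0_norm; lra.
move=> /cvgrPdist_le /(_ e e0); apply: filterS2 (nbhs_infty_gtr s0) => m s0m.
rewrite sub0r normrN ger0_norm ?exprn_ge0 ?invr_ge0//; apply: le_trans.
by rewrite distrC; apply: (passage_approx_near ndf _ ts0); rewrite s00 ltW.
Qed.

Lemma within_cvg_comp (R : realType) (g : R -> R) (u : nat -> R) (a : R) :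
  {within `[0, +oo[, continuous g} -> (forall n, 0 <= u n) -> 0 <= a ->
  u n @[n --> \oo] --> a -> g (u n) @[n --> \oo] --> g a.
Proof.
move=> /subspace_continuousP gc u0 a0 ua A gA.
have := gc a; rewrite /= in_itv/= andbT => /(_ a0 A gA) h.
have h' : nbhs a [set y | y \in `[0, +oo[ -> A (g y)] := h.
have uA : \forall n \near \oo, u n \in `[0, +oo[ -> A (g (u n)) := ua _ h'.
by apply: filterS uA => n; apply; rewrite in_itv/= andbT.
Qed.

(** * Divergence for the time-changed Brownian motion *)

Section time_changed_variation.
Context d (T : measurableType d) (R : realType) (P : probability T R).
Variables (beta alpha : R) (W S : R -> {RV P >-> R}) (Z : {mfun T >-> C01 R}).
Hypotheses (beta0 : 0 < beta) (alpha0 : 0 < alpha).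
Hypotheses (hW : is_brownian_motion W) (hS : is_stable_subordinator beta S).
Hypothesis hWS : independent_processes W S.
Hypothesis hZ : is_path_of P (time_changed_BM beta alpha W S) Z.

(** The level at which the inverse subordinator is evaluated for the time [dyadic n k]. The power
    map fixes 0 and 1, so the levels run from 0 to 1. *)
Let tau n k : R := (Num.min 1 (k%:R / 2 ^+ n)) `^ (alpha / beta).

Let ab0 : 0 < alpha / beta. Proof. exact: divr_gt0. Qed.

Let min0 n k : 0 <= Num.min 1 (k%:R / 2 ^+ n) :> R.
Proof. by rewrite le_min ler01 divr_ge0. Qed.

Let tau_homo n : nondecreasing_seq (tau n).
Proof.
move=> j k jk; apply: ge0_ler_powR; rewrite ?nnegrE//; first exact: ltW.
rewrite le_min ge_min lexx/= ge_min orbC ler_pM2r ?invr_gt0 ?exprn_gt0//.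
by rewrite ler_nat jk.
Qed.

Let tau0 n : tau n 0 = 0.
Proof. by rewrite /tau mul0r (min_idPr _)// powR0// gt_eqF. Qed.

Let tau1 n : tau n (2 ^ n) = 1.
Proof. by rewrite /tau natrX mulfV ?expf_neq0// minxx powR1. Qed.

Let tau_le1 n k : tau n k <= 1.
Proof.
have one : 1 `^ (alpha / beta) = 1 :> R by rewrite powR1.
rewrite -[leRHS]one.
rewrite /tau; apply: ge0_ler_powR.
- exact: ltW.
- by rewrite nnegrE.
- by rewrite nnegrE.
- by rewrite ge_min lexx.
Qed.

Let D n m x := \sum_(k < 2 ^ n)
  (W (passage_approx (fun s => S s x) m (tau n k.+1)) x -
   W (passage_approx (fun s => S s x) m (tau n k)) x) ^+ 2.

Let mD n m : measurable_fun setT (D n m).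
Proof.
apply: measurable_sum => k; apply: measurable_funX.
by apply: measurable_funB; exact: measurable_time_changed.
Qed.

(** If [S (2^-r) <= 1], the approximate passage time grows by at least [2^-r] between levels 0 and
    1, which gives the first term. Otherwise the integrand is at most 1, on an event of probability
    at most [2 * 2^-r]. *)
Let laplace_D (l : R) n m r : 0 <= l -> (r <= m)%N -> (2 <= m)%N ->
  (\int[P]_x (expR (- l * D n m x))%:E <=
   ((Num.sqrt (1 + 2 * l * 2^-1 ^+ r))^-1 + 2 * 2^-1 ^+ r)%:E)%E.
Proof.
move=> l0 rm m2; have r0 : 0 < 2^-1 ^+ r :> R by rewrite exprn_gt0.
apply: (le_trans (laplace_passage hW hWS _ _ l0 (@tau_homo n))).
rewrite tau0 tau1; set c := (Num.sqrt _)^-1.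
set A := [set x | 1 < S (2^-1 ^+ r) x].
have mA : measurable A.
  have := measurable_funPTI (S (2^-1 ^+ r)) (measurable_itv `]1, +oo[).
  by congr measurable; apply/seteqP; split => x /=; rewrite in_itv/= andbT.
have sq0 : 0 < 1 + 2 * l * 2^-1 ^+ r by have := mulr_ge0 l0 (ltW r0); lra.
have c0 : 0 <= c by rewrite invr_ge0 sqrtr_ge0.
apply: (@le_trans _ _ (\int[P]_x (c%:E + (\1_A x)%:E))%E); last first.
  rewrite ge0_integralD//; last first.
    by apply/measurable_EFinP.
  rewrite integral_probability_cst integral_indic// setIT EFinD leeD2l//.
  by apply: (subordinator_tail hS); exact: ltW.
apply: ae_ge0_le_integral => //.
- by apply/measurable_EFinP; exact: measurable_sqrtV_passage_approx.
- by move=> x _; rewrite -EFinD lee_fin addr_ge0.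
- by apply/measurable_EFinP; exact: measurable_funD.
apply: filterS (subordinator_homo hS) => x [S0 Sx] _.
rewrite -EFinD lee_fin indicE.
have dU : 0 <= passage_approx (fun s => S s x) m 1 - passage_approx (fun s => S s x) m 0.
  by rewrite subr_ge0; exact: passage_approx_homo.
have dl := mulr_ge0 l0 dU.
have [/set_mem xA|/negP] := boolP (x \in A).
  apply: (@le_trans _ _ 1); last by rewrite lerDr.
  rewrite invf_le1 ?sqrtr_gt0; last by lra.
  by rewrite -[leLHS]sqrtr1 ler_sqrt; lra.
rewrite inE /A/= => /negP; rewrite -leNgt => Sr; rewrite addr0.
have := passage_approx_jump S0 Sx Sr rm m2.
move=> /(ler_wpM2l l0) jump.
rewrite lef_pV2 ?posrE ?sqrtr_gt0//; last by lra.
by rewrite ler_sqrt; lra.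
Qed.

(** For fixed [n] the sum is finite; each approximate passage time converges as [m] grows, and
    Brownian paths are continuous. *)
Let cvg_D n : {ae P, forall x,
  D n m x @[m --> \oo] --> dyadic_variation n (Z x)}.
Proof.
apply: filterS2 (filterI (bm_continuous hW) hZ)
  (filterI (subordinator_homo hS) (subordinator_exceeds hS)).
move=> x [Wx Zx] [[_ Sx] [j Sj]].
have Sh s s' : 0 <= s -> s <= s' -> S s x <= S s' x.
  by move=> s0; rewrite le_eqVlt => /predU1P[->//|/(Sx _ _ s0)/ltW].
have cvgW k : W (passage_approx (fun s => S s x) m (tau n k)) x @[m --> \oo] -->
    \val (Z x) (dyadic R n k).
  (* All levels are at most 1, so one time [j] exceeds them all and bounds every passage time. *)
  have tauS : tau n k < S j%:R x by rewrite (le_lt_trans (tau_le1 n k)).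
  rewrite Zx; apply: (@within_cvg_comp _ (fun t => W t x)) => //.
  - by move=> m; exact: passage_approx_ge0.
  - by apply: lb_le_inf => [|s []//]; exists j%:R.
  - exact: (cvg_passage_approx Sh _ tauS).
apply: cvg_big => [|k _]; first exact: add_continuous.
rewrite expr2; under eq_fun do rewrite expr2.
by apply: cvgM; apply: cvgB; exact: cvgW.
Qed.

(** The integrands lie between 0 and 1, so dominated convergence in [m] transfers the bound on
    [D n m], which depends on neither [n] nor [m]. *)
Lemma laplace_dyadic_variation (l : R) n r : 0 <= l ->
  (\int[P]_x (expR (- l * dyadic_variation n (Z x)))%:E <=
   ((Num.sqrt (1 + 2 * l * 2^-1 ^+ r))^-1 + 2 * 2^-1 ^+ r)%:E)%E.
Proof.
move=> l0.
have mexp f : measurable_fun setT f ->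
    measurable_fun setT (fun x : T => (expR (- l * f x))%:E).
  move=> mf; apply/measurable_EFinP; apply: measurableT_comp => //.
  exact: measurable_funM.
have mV : measurable_fun setT (fun x => dyadic_variation n (Z x)).
  by apply: measurableT_comp => //; exact: measurable_dyadic_variation.
have [|||||_ _ cvgI] := @dominated_convergence _ _ _ P _ measurableT
  (fun m x => (expR (- l * D n m x))%:E)
  (fun x => (expR (- l * dyadic_variation n (Z x)))%:E) (cst 1%E).
- by move=> m; exact: mexp.
- exact: mexp.
- apply: filterS (cvg_D n) => x cvgx _; apply: cvg_EFin; first exact: nearW.
  apply: continuous_cvg; first exact: continuous_expR.
  by apply: cvgM; [exact: cvg_cst|exact: cvgx].
- exact: finite_measure_integrable_cst.
- apply: aeW => x m _; rewrite /= lee_fin ger0_norm ?expR_ge0//.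
  rewrite -[leRHS]expR0 ler_expR mulNr oppr_le0 mulr_ge0//.
  by apply: sumr_ge0 => k _; exact: sqr_ge0.
rewrite -(cvg_lim _ cvgI)//; apply: lime_le.
  by apply/cvg_ex; eexists; exact: cvgI.
exists (maxn r 2) => // m /=; rewrite geq_max => /andP[rm m2].
exact: laplace_D.
Qed.

Lemma time_changed_infinite_variation :
  distribution P Z (~` infinite_variation (R := R)) = 0%E.
Proof.
(* The constant 3 collects [2^-r] from the inverse square root and [2 * 2^-r] from the tail of the
   subordinator. *)
apply: (@null_cvg0_laplace _ _ _ P (fun n x => dyadic_variation n (Z x))
  (Z @^-1` (~` infinite_variation (R := R))) 3).
- move=> n; apply: measurableT_comp => //; exact: measurable_dyadic_variation.
- by move=> n x; exact: dyadic_variation_ge0.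
- by apply: measurable_funPTI; apply: measurableC; exact: measurable_infinite_variation.
- by move=> x /=; exact: dyadic_variation_cvg0.
move=> r; have r0 : 0 < 2^-1 ^+ r :> R by rewrite exprn_gt0.
set a : R := 2^-1 ^+ r in r0 *.
(* with this [l], [1 + 2 l a >= a^-2] *)
exists (2^-1 * a ^- 3); first by rewrite mulr_ge0// invr_ge0 exprn_ge0// ltW.
move=> n; apply: (le_trans (laplace_dyadic_variation n r _)).
  by rewrite mulr_ge0// invr_ge0 exprn_ge0// ltW.
rewrite lee_fin -/a.
have -> : 2 * (2^-1 * a ^- 3) * a = a ^- 2 by field; rewrite gt_eqF.
suff : (Num.sqrt (1 + a ^- 2))^-1 <= a by lra.
rewrite -[leRHS]invrK lef_pV2 ?posrE ?invr_gt0 ?sqrtr_gt0//; last first.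
  by rewrite addr_gt0// invr_gt0 exprn_gt0.
rewrite -[leLHS]gtr0_norm ?invr_gt0// -sqrtr_sqr ler_sqrt; last first.
  by rewrite addr_ge0// invr_ge0 exprn_ge0// ltW.
by rewrite exprVn lerDr.
Qed.

End time_changed_variation.

Theorem theorem9 (R : realType) (beta alpha : R)
    (hbeta : 0 < beta < 1) (halpha : 1 < alpha < 2)
    (d1 : measure_display) (T1 : measurableType d1) (P1 : probability T1 R)
    (B : R -> {RV P1 >-> R}) (hB : is_ggBm beta alpha B)
    (d2 : measure_display) (T2 : measurableType d2) (P2 : probability T2 R)
    (W S : R -> {RV P2 >-> R})
    (hW : is_brownian_motion W) (hS : is_stable_subordinator beta S)
    (hWS : independent_processes W S)
    (pathB : {mfun T1 >-> C01 R}) (hpathB : is_path_of P1 B pathB)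
    (pathX : {mfun T2 >-> C01 R})
    (hpathX : is_path_of P2 (time_changed_BM beta alpha W S) pathX) :
  mutually_singular (distribution P1 pathB) (distribution P2 pathX).
Proof.
have /andP[beta0 _] := hbeta; have /andP[alpha1 _] := halpha.
(* This set is null for the grey Brownian law, and its complement is null for the time-changed
   law. *)
exists (@infinite_variation R); split.
- exact: measurable_infinite_variation.
- exact: (ggBm_finite_variation beta0 alpha1 hB hpathB).
- exact: (time_changed_infinite_variation beta0 (lt_trans ltr01 alpha1) hW hS hWS hpathX).
Qed.
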